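(* Let $L^2\subset\mathbb{R}^4$ be a smooth oriented surface, let $\mathcal S_-(\mathbb{R}^4)|_L = V_+\oplus V_-$ be the splitting of the restricted negative spinor bundle into two rank $2$ real vector bundles over $L$ described in the context, and let $\psi$ be a smooth section of $V_-$ over $L$. Let $$X_\psi = \{(x,\chi+\psi_x)\in \mathcal S_-(\mathbb{R}^4)|_L : x\in L,\ \chi\in (V_+)_x\}.$$ Then $X_\psi$ is a Cayley submanifold of $\mathbb{R}^8\cong\mathcal S_-(\mathbb{R}^4)$ if and only if $L$ is minimal in $\mathbb{R}^4$ and $\psi$ is a holomorphic section of $V_-$.
   Context: Here $\mathcal S_-$ denotes the bundle of negative chirality spinors. Write the octonions as $\mathbb{O}=\mathbb{H}\oplus\mathbb{H}\mathbf e$ with product $(a+b\mathbf e)(c+d\mathbf e) = (ac-\bar d b) + (da+b\bar c)\mathbf e$ for $a,b,c,d\in\mathbb{H}$, where $\mathbb{H}$ has the standard basis $\mathbf 1,\mathbf i,\mathbf j,\mathbf k$. Identify $\mathbb{R}^4$, and each tangent and cotangent space $T_x\mathbb{R}^4\cong T^*_x\mathbb{R}^4$, with $\mathbb{H}\mathbf e$, and identify each fibre $(\mathcal S_-)_x$ with $\mathbb{H}$ and $(\mathcal S_+)_x$ with $\mathbb{H}\mathbf e$. Clifford multiplication of a spinor $s$ by a cotangent vector $\alpha$ is $\gamma(\alpha)(s)=\alpha s$ (octonion product). The total space $\mathcal S_-(\mathbb{R}^4)$ is thus $\mathbb{H}\mathbf e\oplus\mathbb{H}=\mathbb{O}\cong\mathbb{R}^8$,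 with its Euclidean metric and standard $\mathrm{Spin}(7)$-structure. The connection $\nabla$ on $\mathcal S_-(\mathbb{R}^4)$ is the one induced by the (flat) Levi-Civita connection of $\mathbb{R}^4$. Cayley: a $4$-dimensional subspace of $\mathbb{O}$ is Cayley if, for an orthogonal basis $a,b,c,d$ of it, the purely imaginary fourfold product $\mathrm{Im}(a\times b\times c\times d) = \mathrm{Im}\left(\bar a(b(\bar c d))\right)$ vanishes. A $4$-dimensional submanifold of $\mathbb{R}^8\cong\mathbb{O}$ is Cayley (for a suitable orientation) if all its tangent spaces are Cayley subspaces. The bundles $V_\pm$: for an oriented orthonormal coframe $e^1,e^2$ of $L$ at $x$, let $r=\gamma(e^1)\gamma(e^2)$. It is independent of the choice of oriented orthonormal coframe, satisfies $r^2=-1$ on $\mathcal S_-$, and is given on $(\mathcal S_-)_x\cong\mathbb{H}$ by right multiplication by the unit imaginary quaternion $\mathbf j_{L} = e^1e^2$ (octonion product, which lies in $\mathrm{Im}\,\mathbb{H}$). Then $(V_+)_x = \mathrm{span}\{\mathbf 1,\mathbf j_L\}$ and $(V_-)_x = (V_+)_x^\perp$ in $\mathbb{H}$. Holomorphic structure: $L$ is a complex curve with complex structure $Je^1=e^2$, $Je^2=-e^1$. $V_+$ is a complex line bundle with $J_+(\mathbf 1)=\mathbf j_L$, $J_+(\mathbf j_L)=-\mathbf 1$. The bundle $V_-$, as the oriented orthogonal complement of $V_+$ in the oriented rank $4$ bundle $\mathcal S_-(\mathbb{R}^4)|_L$ (fibres $\mathbb{H}$ oriented by $\mathbf 1,\mathbf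 i,\mathbf j,\mathbf k$, and $V_+$ by $\mathbf 1,\mathbf j_L$), is a complex line bundle whose complex structure $J_-$ is the positive $90^\circ$ rotation (for example, if $\mathbf j_L=\mathbf i$, then $J_-\mathbf j=\mathbf k$). With $\nabla^{V_-}$ the connection on $V_-$ obtained from $\nabla$ by orthogonal projection, $V_-$ is a holomorphic line bundle with $\bar\partial = (\nabla^{V_-})^{(0,1)}$. Thus $\psi$ is holomorphic iff $\nabla^{V_-}_{e_1}\psi + J_-(\nabla^{V_-}_{e_2}\psi)=0$ for local oriented orthonormal tangent frames $\{e_1,e_2\}$ of $L$. $L$ is minimal if the trace of its second fundamental form vanishes in every normal direction. *)

(* Defs.v *)
From HB Require Import structures.
From mathcomp Require Import all_boot all_order all_algebra.
From mathcomp Require Import all_classical all_reals all_analysis.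

Set Implicit Arguments.
Unset Strict Implicit.
Unset Printing Implicit Defensive.

Import Order.TTheory GRing.Theory Num.Theory.
Import numFieldNormedType.Exports.

Local Open Scope classical_set_scope.
Local Open Scope ring_scope.

Section Euclidean.
Context {R : realType} {n : nat}.

Definition dot (u v : 'rV[R]_n) : R := \sum_i u 0 i * v 0 i.

Definition orthogonal_space (W : set 'rV[R]_n) : set 'rV[R]_n :=
  [set v | forall w, W w -> dot v w = 0].

Definition row_span k (E : 'M[R]_(k, n)) : set 'rV[R]_n :=
  [set v | (v <= E)%MS].

Definition orthonormal_rows k (E : 'M[R]_(k, n)) : Prop :=
  forall i j, dot (row i E) (row j E) = (i == j)%:R.

Definition orthogonal_basis k (W : set 'rV[R]_n) (E : 'M[R]_(k, n)) : Prop :=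
  [/\ forall i j, i != j -> dot (row i E) (row j E) = 0,
      forall i, row i E != 0
    & W = row_span E].

Definition orthonormal_basis k (W : set 'rV[R]_n) (E : 'M[R]_(k, n)) : Prop :=
  orthonormal_rows E /\ W = row_span E.

(* When W is a linear subspace the set below is a singleton. *)
Definition orth_proj (W : set 'rV[R]_n) (z : 'rV[R]_n) : 'rV[R]_n :=
  xget 0 [set w | W w /\ orthogonal_space W (z - w)].

End Euclidean.

Section Smooth.
Context {R : realType} {m n : nat}.

(* Meant for open U; Ck k.+1 amounts to being C^1 with all directional
   derivatives of class C^k. *)
Fixpoint Ck (k : nat) (U : set 'rV[R]_m) (f : 'rV[R]_m -> 'rV[R]_n) : Prop :=
  match k with
  | 0 => forall x, U x -> {for x, continuous f}
  | k'.+1 => (forall x, U x -> differentiable f x) /\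
             (forall v, Ck k' U (fun x => 'D_v f x))
  end.

Definition smooth_on (U : set 'rV[R]_m) (f : 'rV[R]_m -> 'rV[R]_n) : Prop :=
  forall k, Ck k U f.

End Smooth.

Section Submanifolds.
Context {R : realType} {n : nat}.
Implicit Types (M : set 'rV[R]_n) (p X Y : 'rV[R]_n).

(* A smooth injective immersion of an open V into R^n which is open as a map
   onto M with the subspace topology, hence a homeomorphism of V onto a
   relatively open subset of M. *)
Definition local_param k M (V : set 'rV[R]_k) (phi : 'rV[R]_k -> 'rV[R]_n) :=
  [/\ open V,
      smooth_on V phi,
      forall u, V u -> row_free (jacobian phi u),
      forall u u', V u -> V u' -> phi u = phi u' -> u = u'
    & forall W : set 'rV[R]_k, open W -> W `<=` V ->
        exists2 U : set 'rV[R]_n, open U & phi @` W = M `&` U].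

Definition submanifold (k : nat) M : Prop :=
  forall p, M p -> exists (V : set 'rV[R]_k) phi u,
    [/\ local_param M V phi, V u & phi u = p].

Definition tangent_space (k : nat) M p : set 'rV[R]_n :=
  [set X | exists (V : set 'rV[R]_k) phi u w,
    [/\ local_param M V phi, V u, phi u = p & 'D_w phi u = X]].

Definition normal_space (k : nat) M p : set 'rV[R]_n :=
  orthogonal_space (tangent_space k M p).

Definition smooth_along (k m : nat) M (f : 'rV[R]_n -> 'rV[R]_m) : Prop :=
  forall (V : set 'rV[R]_k) phi, local_param M V phi -> smooth_on V (f \o phi).

(* Derivative at p of a map defined along M, in the tangent direction X; f is
   not differentiated off M. For f smooth along M and X tangent to M the value
   does not depend on the parametrization. *)
Definition deriv_along (k m : nat) M (f : 'rV[R]_n -> 'rV[R]_m) p X : 'rV[R]_m :=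
  xget 0 [set d | exists (V : set 'rV[R]_k) phi u w,
    [/\ local_param M V phi, V u, phi u = p, 'D_w phi u = X
      & 'D_w (f \o phi) u = d]].

(* II(X, Y) is the normal part of the derivative in the direction X of a tangent
   vector field extending Y; the extension is the one with constant
   coefficients in a local parametrization, on which II does not depend. *)
Definition second_fundamental_form (k : nat) M p X Y : 'rV[R]_n :=
  xget 0 [set b | exists (V : set 'rV[R]_k) phi u w w',
    [/\ local_param M V phi, V u & phi u = p] /\
    [/\ 'D_w phi u = X, 'D_w' phi u = Y
      & b = orth_proj (normal_space k M p) ('D_w (fun z => 'D_w' phi z) u)]].

Definition minimal (k : nat) M : Prop :=
  forall p (E : 'M[R]_(k, n)) (nu : 'rV[R]_n),
    M p -> orthonormal_basis (tangent_space k M p) E -> normal_space k M p nu ->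
    \sum_(i < k) dot (second_fundamental_form k M p (row i E) (row i E)) nu = 0.

(* An orientation of a surface M, given by its positive frames: or p E says that
   the rows of E form a positively oriented basis of the tangent space at p. *)
Definition orientation M (or : 'rV[R]_n -> 'M[R]_(2, n) -> Prop) : Prop :=
  [/\ forall p E, or p E ->
        [/\ M p, row_free E & tangent_space 2 M p = row_span E],
      forall p E (A : 'M[R]_2), or p E -> (or p (A *m E) <-> 0 < \det A)
    & forall p, M p -> exists (V : set 'rV[R]_2) phi u,
        [/\ local_param M V phi, V u, phi u = p
          & forall u', V u' -> or (phi u') (jacobian phi u')]].

End Submanifolds.

Section Octonions.
Context {R : realType}.

(* The quaternion a + b i + c j + d k. *)
Definition quat (a b c d : R) : 'rV[R]_4 := \row_(i < 4) [:: a; b; c; d]`_i.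

Definition quat1 : 'rV[R]_4 := quat 1 0 0 0.

Definition qconj (x : 'rV[R]_4) : 'rV[R]_4 :=
  quat (x 0 0) (- x 0 1) (- x 0 2) (- x 0 3).

Definition qmul (x y : 'rV[R]_4) : 'rV[R]_4 :=
  quat (x 0 0 * y 0 0 - x 0 1 * y 0 1 - x 0 2 * y 0 2 - x 0 3 * y 0 3)
       (x 0 0 * y 0 1 + x 0 1 * y 0 0 + x 0 2 * y 0 3 - x 0 3 * y 0 2)
       (x 0 0 * y 0 2 - x 0 1 * y 0 3 + x 0 2 * y 0 0 + x 0 3 * y 0 1)
       (x 0 0 * y 0 3 + x 0 1 * y 0 2 - x 0 2 * y 0 1 + x 0 3 * y 0 0).

(* The octonion a + b e. *)
Definition oct (a b : 'rV[R]_4) : 'rV[R]_(4 + 4) := row_mx a b.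

Definition omul (x y : 'rV[R]_(4 + 4)) : 'rV[R]_(4 + 4) :=
  let a := lsubmx x in let b := rsubmx x in
  let c := lsubmx y in let d := rsubmx y in
  oct (qmul a c - qmul (qconj d) b) (qmul d a + qmul b (qconj c)).

Definition oconj (x : 'rV[R]_(4 + 4)) : 'rV[R]_(4 + 4) :=
  oct (qconj (lsubmx x)) (- rsubmx x).

Definition oim (x : 'rV[R]_(4 + 4)) : 'rV[R]_(4 + 4) :=
  x - x 0 0 *: oct quat1 0.

(* a x b x c x d for mutually orthogonal a, b, c, d. *)
Definition fourfold (a b c d : 'rV[R]_(4 + 4)) : 'rV[R]_(4 + 4) :=
  omul (oconj a) (omul b (omul (oconj c) d)).

Definition cayley_subspace (W : set 'rV[R]_(4 + 4)) : Prop :=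
  exists2 B : 'M[R]_(4, 4 + 4), orthogonal_basis W B
    & oim (fourfold (row 0 B) (row 1 B) (row 2 B) (row 3 B)) = 0.

Definition cayley_submanifold (M : set 'rV[R]_(4 + 4)) : Prop :=
  submanifold 4 M /\ forall p, M p -> cayley_subspace (tangent_space 4 M p).

End Octonions.

(* x in R^4 stands for the octonion x e and s in the fibre H of S_- for s + 0 e,
   so that the point (x, s) of the total space of S_- is oct s x. *)
Section SpinorsAlongSurface.
Context {R : realType}.
Variables (L : set 'rV[R]_4) (or : 'rV[R]_4 -> 'M[R]_(2, 4) -> Prop).
Implicit Types (p X : 'rV[R]_4) (psi : 'rV[R]_4 -> 'rV[R]_4).

(* A chosen oriented orthonormal (co)frame; the objects built from it below do
   not depend on the choice. *)
Definition oframe p : 'M[R]_(2, 4) :=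
  xget 0 [set E | or p E /\ orthonormal_rows E].

(* The H-component of the octonion product e^1 e^2, which lies in Im H. *)
Definition jL p : 'rV[R]_4 :=
  lsubmx (omul (oct 0 (row 0 (oframe p))) (oct 0 (row 1 (oframe p)))).

Definition Vplus p : set 'rV[R]_4 :=
  [set s | exists a b : R, s = a *: quat1 + b *: jL p].

Definition Vminus p : set 'rV[R]_4 := orthogonal_space (Vplus p).

Definition JL p X : 'rV[R]_4 :=
  dot X (row 0 (oframe p)) *: row 1 (oframe p) -
  dot X (row 1 (oframe p)) *: row 0 (oframe p).

(* w is the image of v under the positive quarter turn of V_-: for v != 0 the
   basis 1, j_L, v, w of H is positively oriented. *)
Definition Jminus p (v : 'rV[R]_4) : 'rV[R]_4 :=
  xget 0 [set w | [/\ Vminus p w, dot w w = dot v v, dot v w = 0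
    & 0 <= \det (\matrix_(i < 4) [:: quat1; jL p; v; w]`_i)]].

Definition smooth_section_Vminus psi : Prop :=
  smooth_along 2 L psi /\ forall p, L p -> Vminus p (psi p).

Definition nablaVminus psi p X : 'rV[R]_4 :=
  orth_proj (Vminus p) (deriv_along 2 L psi p X).

Definition dbar psi p X : 'rV[R]_4 :=
  2^-1 *: (nablaVminus psi p X + Jminus p (nablaVminus psi p (JL p X))).

Definition holomorphic_section psi : Prop :=
  forall p X, L p -> tangent_space 2 L p X -> dbar psi p X = 0.

Definition Xpsi psi : set 'rV[R]_(4 + 4) :=
  [set z | exists p chi, [/\ L p, Vplus p chi & z = oct (chi + psi p) p]].

End SpinorsAlongSurface.

(* Main.v *)
Require Import Defs.
From mathcomp Require Import all_boot all_order all_algebra.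
From mathcomp Require Import all_classical all_reals all_analysis.
From mathcomp Require Import ring lra.

(* Let j = jL and pi the projection onto V_-.  At a point of X_psi with fibre
   coordinate b along j the tangent space is spanned by 1, j (in the fibre) and
   the vectors T_i = (b D_i j + D_i psi, e_i), for an oriented orthonormal frame
   e_1, e_2 of L.  A Cayley space is closed under (x, y, z) |-> x (conj y z), so
   a Cayley space containing 1 and j is closed under left multiplication by j;
   since j (x e_1) = (j x) e_2, this forces pi of the fibre part of T_2 to be j
   times that of T_1, and conversely 1, j, T, j T always span a Cayley space.
   The condition is affine in b.  Its constant term says that psi is holomorphic
   and its linear term, pi (D_2 j) = j pi (D_1 j), says that L is minimal: the
   formula j = - conj e_2 e_1 gives
     pi (D_2 j) - j pi (D_1 j) = conj e_1 (II (e_1, e_1) + II (e_2, e_2)).  *)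

Set Implicit Arguments.
Unset Strict Implicit.
Unset Printing Implicit Defensive.

Import Order.TTheory GRing.Theory Num.Theory.
Import numFieldNormedType.Exports.

Local Open Scope classical_set_scope.
Local Open Scope ring_scope.

(** * Differentiability *)

Section Differentiability.
Context {R : realType}.
Implicit Types V W : normedModType R.

(** Tangent vectors, derivatives along L and the second fundamental form are defined through
    arbitrary local parametrizations, of which one only knows that they are injective smooth
    immersions, open onto their images. The analytic base is therefore that two parametrizations
    through a point differ by a map differentiable there. Second derivatives of that map never
    enter: [shape_operator] rewrites normal curvature as minus a pairing with a first derivative of
    a field defined on L.

    A second obstacle is that [oframe] is an arbitrary choice at each point, without any continuity.
    Computations use instead the frame ['D_(row i W) phi] for a constant matrix [W]: it is smooth
    and positively oriented, but orthonormal only at the point under study, and [jL] is a normalized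
    alternating product of it. Differentiating the normalizing factor yields a multiple of j, which
    the projection onto V_- discards. What remains contains the second derivatives of [phi]; the
    mixed one occurs in both D_1 j and D_2 j, and the two occurrences are identified by symmetry. *)

Lemma differentiable_epsP V W (f : V -> W) (df : {linear V -> W}) x :
  continuous df ->
  (forall e : R, 0 < e ->
     \forall h \near 0, `|f (h + x) - f x - df h| <= e * `|h|) <->
  differentiable f x /\ 'd f x = df :> (V -> W).
Proof.
move=> cdf.
have E h : (f \o shift x - (cst (f x) + df)) h = f (h + x) - f x - df h.
  by rewrite !fctE /= opprD addrA.
split=> [H | [df_f e] ep e0].
  have {}E : f \o shift x = cst (f x) + df +o_ 0 id.
    apply/eqaddoP => e e0; near=> h.
    by rewrite E; near: h; exact: H.
  have D := diff_unique cdf E; split=> //.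
  by apply/diff_locallyP; rewrite D.
have := diff_locally df_f; rewrite e => /eqaddoP/(_ _ e0).
by apply: filterS => h /=; rewrite E.
Unshelve. all: by end_near. Qed.

Lemma near_eq_diff V W (f g : V -> W) x :
  (\forall y \near x, f y = g y) -> differentiable f x ->
  differentiable g x /\ 'd g x = 'd f x :> (V -> W).
Proof.
move=> fg df; have cdf := diff_continuous df.
apply/(differentiable_epsP _ _ cdf) => e e0.
have /(differentiable_epsP _ _ cdf)/(_ e e0) H := conj df (erefl ('d f x : V -> W)).
have gx := nbhs_singleton fg.
move: fg; rewrite (near_shift 0 x) => fg; near=> h.
rewrite -gx (_ : g (h + x) = f (h + x)); first by near: h; exact: H.
by apply/esym; near: h; apply: filterS fg => h /=; rewrite subr0.
Unshelve. all: by end_near. Qed.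

Lemma near_eq_differentiable V W (f g : V -> W) x :
  (\forall y \near x, f y = g y) -> differentiable f x -> differentiable g x.
Proof. by move=> fg /(near_eq_diff fg)[]. Qed.

Lemma differentiable_rowP V n (f : V -> 'rV[R]_n) x :
  (forall i, differentiable (fun y => f y 0 i) x) <-> differentiable f x.
Proof.
split=> [H|H i]; last exact: differentiable_comp H (differentiable_coord _ _ _).
have -> : f = \sum_i (fun y => f y 0 i *: delta_mx 0 i).
  by apply/funext => y; rewrite fct_sumE {1}[f y]row_sum_delta.
by apply: differentiable_sum => i; exact: differentiableZl.
Qed.

Lemma derive_coord V n (f : V -> 'rV[R]_n) x v i :
  differentiable f x -> ('D_v f x) 0 i = 'D_v (fun y => f y 0 i) x.
Proof. by move=> df; rewrite derive_mx ?mxE//; exact: diff_derivable. Qed.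

Lemma linear_row_continuous n W (f : {linear 'rV[R]_n -> W}) : continuous f.
Proof.
move=> x; apply: differentiable_continuous.
have -> : (f : 'rV[R]_n -> W) = \sum_i (fun y : 'rV[R]_n => y 0 i *: f (delta_mx 0 i)).
  apply/funext => y; rewrite fct_sumE {1}[y]row_sum_delta linear_sum.
  by apply: eq_bigr => i _; rewrite linearZ.
apply: differentiable_sum => i.
exact: (differentiableZl _ (differentiable_coord _ _ _)).
Qed.

End Differentiability.

(** * Continuous lifts through immersions *)

Section Lifting.
Context {R : realType}.

(* With A a right inverse of the Jacobian J of phi at y u, the increment
   k of y satisfies k = k *m J *m A = ('d (phi \o y) u h) *m A + o(h) + o(k). *)
Lemma differentiable_lift m k n (phi : 'rV[R]_k -> 'rV[R]_n)
    (y : 'rV[R]_m -> 'rV[R]_k) u :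
  {for u, continuous y} -> differentiable phi (y u) ->
  row_free (jacobian phi (y u)) -> differentiable (phi \o y) u ->
  differentiable y u.
Proof.
move=> cy dphi free dpsi.
pose A := pinvmx (jacobian phi (y u)).
have JA : jacobian phi (y u) *m A = 1%:M by exact: mulmxVp.
have [K K0 HK] := linear_lipschitz (@linear_row_continuous R n _ (mulmxr A)).
pose dy : {linear 'rV[R]_m -> 'rV[R]_k} := mulmxr A \o 'd (phi \o y) u.
have cdy : continuous dy by exact: linear_row_continuous.
have [C C0 HC] := linear_lipschitz cdy.
suff [] : differentiable y u /\ 'd y u = dy :> ('rV[R]_m -> 'rV[R]_k) by [].
apply/(differentiable_epsP _ _ cdy) => e e0.
(* After multiplication by [K], the bounds 1 and 1/2 allow [|k0|] to be absorbed, giving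
   [|k0| <= 2 (C + 1) |h|]; with this, the bounds [e / 2] and [e / (4 (C + 1))] make each of the two
   errors at most [e / 2 * |h|]. *)
pose e2 := Num.min (e / 2) 1 / K.
pose e1 := Num.min (1 / 2) (e / (4 * (C + 1))) / K.
have C1 : 0 < 4 * (C + 1) by lra.
have e20 : 0 < e2 by rewrite divr_gt0 // lt_min ltr01 andbT divr_gt0.
have e10 : 0 < e1 by rewrite divr_gt0 // lt_min !divr_gt0.
have /(differentiable_epsP _ _ (diff_continuous dphi))/(_ _ e10) H1 :=
  conj dphi (erefl ('d phi (y u) : 'rV[R]_k -> _)).
have /(differentiable_epsP _ _ (diff_continuous dpsi))/(_ _ e20) H2 :=
  conj dpsi (erefl ('d (phi \o y) u : 'rV[R]_m -> _)).
have {}H1 : \forall z \near y u,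
    `|phi z - phi (y u) - 'd phi (y u) (z - y u)| <= e1 * `|z - y u|.
  rewrite (near_shift 0); apply: filterS H1 => h /=.
  by rewrite subr0 addrK.
have {}H1 : \forall x \near u,
    `|phi (y x) - phi (y u) - 'd phi (y u) (y x - y u)| <= e1 * `|y x - y u|.
  exact: cy H1.
move: H1; rewrite (near_shift 0) => H1.
near=> h.
have H2h : `|phi (y (h + u)) - phi (y u) - 'd (phi \o y) u h| <= e2 * `|h|.
  by near: h; exact: H2.
have : `|phi (y (h + (u - 0))) - phi (y u) - 'd phi (y u) (y (h + (u - 0)) - y u)|
    <= e1 * `|y (h + (u - 0)) - y u| by near: h; exact: H1.
rewrite subr0; set k0 := y (h + u) - y u => H1h.
have dyE : dy h = 'd (phi \o y) u h *m A by [].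
have key : k0 - dy h =
    (phi (y (h + u)) - phi (y u) - 'd (phi \o y) u h) *m A -
    (phi (y (h + u)) - phi (y u) - 'd phi (y u) k0) *m A.
  have {1}-> : k0 = 'd phi (y u) k0 *m A.
    by rewrite -(mul_rV_lin1 ('d phi (y u)) k0) -mulmxA JA mulmx1.
  by rewrite dyE -!mulmxBl; congr (_ *m _); rewrite opprB [RHS]addrC subrKA.
have k0E : K * (e2 * `|h|) + K * (e1 * `|k0|) =
    Num.min (e / 2) 1 * `|h| + Num.min (1 / 2) (e / (4 * (C + 1))) * `|k0|.
  by rewrite /e2 /e1; field; rewrite gt_eqF.
have b1 : `|k0 - dy h| <= K * (e2 * `|h|) + K * (e1 * `|k0|).
  rewrite key (le_trans (ler_normB _ _)) // lerD //.
    by rewrite (le_trans (HK _)) // ler_wpM2l // ltW.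
  by rewrite (le_trans (HK _)) // ler_wpM2l // ltW.
rewrite k0E in b1.
have b2 : `|k0| <= C * `|h| + `|k0 - dy h|.
  have {1}-> : k0 = dy h + (k0 - dy h) by rewrite addrC subrK.
  by rewrite (le_trans (ler_normD _ _)) // lerD2r HC.
have h0 := normr_ge0 h; have k00 := normr_ge0 k0.
have m1 : Num.min (e / 2) 1 * `|h| <= e / 2 * `|h|.
  by rewrite ler_wpM2r // ge_min lexx.
have m2 : Num.min (e / 2) 1 * `|h| <= 1 * `|h|.
  by rewrite ler_wpM2r // ge_min lexx orbT.
have m3 : Num.min (1 / 2) (e / (4 * (C + 1))) * `|k0| <= 1 / 2 * `|k0|.
  by rewrite ler_wpM2r // ge_min lexx.
have m4 : Num.min (1 / 2) (e / (4 * (C + 1))) * `|k0| <=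
          (e / (4 * (C + 1))) * `|k0|.
  by rewrite ler_wpM2r // ge_min lexx orbT.
have b3 : `|k0| <= 2 * (C + 1) * `|h| by lra.
have b4 : (e / (4 * (C + 1))) * `|k0| <= (e / (4 * (C + 1))) * (2 * (C + 1) * `|h|).
  by rewrite ler_wpM2l // ltW // divr_gt0.
have b5 : (e / (4 * (C + 1))) * (2 * (C + 1) * `|h|) = e / 2 * `|h|.
  by field; rewrite gt_eqF //; lra.
lra.
Unshelve. all: by end_near. Qed.

End Lifting.

(** * Changes of parametrization of a submanifold *)

Section ChangeOfParametrization.
Context {R : realType} {n k : nat}.
Implicit Types (M : set 'rV[R]_n) (V : set 'rV[R]_k).

Lemma smooth_on_differentiable m l (U : set 'rV[R]_m) (f : 'rV[R]_m -> 'rV[R]_l) x :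
  smooth_on U f -> U x -> differentiable f x.
Proof. by move=> /(_ 1%N)[+ _]; exact. Qed.

Lemma smooth_on_derive m l (U : set 'rV[R]_m) (f : 'rV[R]_m -> 'rV[R]_l) v :
  smooth_on U f -> smooth_on U (fun x => 'D_v f x).
Proof. by move=> sf j; have [_ ] := sf j.+1; exact. Qed.

Lemma local_param_in M V phi u : local_param M V phi -> V u -> M (phi u).
Proof.
move=> [oV _ _ _ /(_ V oV)[//|U _ e]] Vu.
by have [] : (M `&` U) (phi u) by rewrite -e; exists u.
Qed.

Lemma local_param_differentiable M V phi u :
  local_param M V phi -> V u -> differentiable phi u.
Proof. by move=> [_ sphi _ _ _]; exact: smooth_on_differentiable. Qed.

(** Openness of [phi'] onto M makes its inverse continuous there, so [g] is a continuous lift of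
    [phi] through the immersion [phi'], and [differentiable_lift] applies. No inverse function
    theorem is involved. *)
Lemma local_param_change M V phi u V' phi' u' :
  local_param M V phi -> V u -> local_param M V' phi' -> V' u' ->
  phi u = phi' u' ->
  exists g : 'rV[R]_k -> 'rV[R]_k,
    [/\ g u = u', differentiable g u & \forall z \near u, phi z = phi' (g z)].
Proof.
move=> pphi Vu pphi' V'u' e.
have dphi := local_param_differentiable pphi Vu.
have dphi' := local_param_differentiable pphi' V'u'.
have cphi := differentiable_continuous dphi.
have [oV _ _ _ _] := pphi.
have [oV' _ free inj opn] := pphi'.
have nV : \forall z \near u, V z by exact: open_nbhs_nbhs.
have lift (W : set 'rV[R]_k) : open W -> W `<=` V' -> W u' ->
    \forall z \near u, exists2 y, W y & phi' y = phi z.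
  move=> oW WV' Wu'; have [U oU Ue] := opn W oW WV'.
  have Uu : (M `&` U) (phi u) by rewrite -Ue; exists u'.
  have nU : \forall z \near u, U (phi z).
    by apply: cphi; apply: open_nbhs_nbhs; split => //; exact: Uu.2.
  near=> z.
  have [] : (phi' @` W) (phi z).
    rewrite Ue; split; last by near: z.
    by apply: (local_param_in pphi); near: z.
  by move=> y Wy <-; exists y.
(* The inverse of [phi'] applied to [phi z]; the default [u'] occurs only where [phi z] is outside
   the image of [phi'], hence not near [u]. *)
pose g z := xget u' [set y | V' y /\ phi' y = phi z].
have gE z y : V' y -> phi' y = phi z -> g z = y.
  move=> V'y yz; rewrite /g; case: xgetP => [y' _ [V'y' y'z]|/(_ y)[]//].
  by apply: inj => //; rewrite yz.
have gu : g u = u' by exact: gE.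
have gn : \forall z \near u, phi z = phi' (g z).
  have := lift V' oV' (@subset_refl _ _) V'u'.
  by apply: filterS => z [y V'y yz]; rewrite (gE z y).
have cg : {for u, continuous g}.
  move=> B; rewrite gu => nB.
  have := lift (B^° `&` V'); case.
  - by apply: openI => //; exact: open_interior.
  - by move=> ? [].
  - by split.
  move=> e0 e0_gt0 He; exists e0 => // z /He [y [By V'y] yz] /=.
  by rewrite (gE z y) //; exact: interior_subset By.
exists g; split => //.
apply: (differentiable_lift (phi := phi')) => //; rewrite ?gu //; first exact: free.
exact: near_eq_differentiable gn dphi.
Unshelve. all: by end_near. Qed.

(** [A] is the Jacobian of the change of parameters. It is chosen before [F], so that one matrix
    serves both [F := id], which compares tangent vectors, and the map to be differentiated. *)
Lemma param_chain_rule M V phi u V' phi' u' :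
  local_param M V phi -> V u -> local_param M V' phi' -> V' u' ->
  phi u = phi' u' ->
  exists A : 'M[R]_k, forall (W : normedModType R) (F : 'rV[R]_n -> W),
    differentiable (F \o phi') u' -> differentiable (F \o phi) u /\
    forall w, 'D_w (F \o phi) u = 'D_(w *m A) (F \o phi') u'.
Proof.
move=> pphi Vu pphi' V'u' e.
have [g [gu dg gn]] := local_param_change pphi Vu pphi' V'u' e.
exists (jacobian g u) => W F; rewrite -gu => dF.
have dc : differentiable ((F \o phi') \o g) u.
  exact: differentiable_comp.
have gn' : \forall z \near u, ((F \o phi') \o g) z = (F \o phi) z.
  by apply: filterS gn => z /= ->.
have dF' := near_eq_differentiable gn' dc; split=> // w.
have -> : w *m jacobian g u = 'd g u w by rewrite mul_rV_lin1.
rewrite -(near_eq_derive _ gn') (deriveE _ dc) (deriveE _ dF).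
exact: (congr1 (@^~ w) (diff_comp dg dF)).
Qed.

Lemma tangent_spaceE M V phi u :
  local_param M V phi -> V u ->
  tangent_space k M (phi u) = row_span (jacobian phi u).
Proof.
move=> pphi Vu; apply/seteqP; split=> X.
  move=> [V' [phi' [u' [w [pphi' V'u' e <-]]]]].
  have [A /(_ _ id)] := param_chain_rule pphi' V'u' pphi Vu e.
  rewrite -[id \o phi]/phi -[id \o phi']/phi'.
  have d := local_param_differentiable pphi Vu.
  by move=> /(_ d)[_ ->]; rewrite deriveEjacobian // /row_span /= submxMl.
move=> /submxP[w ->]; exists V, phi, u, w; split=> //.
by rewrite deriveEjacobian //; exact: local_param_differentiable pphi Vu.
Qed.

(** Taking [F := id] in the chain rule, equality of the two tangent vectors and injectivity of the
    Jacobian of [phi'] give [w *m A = w']; the same [A] then compares the derivatives of [F]. *)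
Lemma derive_param_indep M (W : normedModType R) (F : 'rV[R]_n -> W)
    V phi u V' phi' u' w w' :
  local_param M V phi -> V u -> local_param M V' phi' -> V' u' ->
  phi u = phi' u' -> differentiable (F \o phi') u' ->
  'D_w phi u = 'D_w' phi' u' ->
  differentiable (F \o phi) u /\ 'D_w (F \o phi) u = 'D_w' (F \o phi') u'.
Proof.
move=> pphi Vu pphi' V'u' e dF eD.
have [A HA] := param_chain_rule pphi Vu pphi' V'u' e.
have [dFphi ->] := HA _ F dF; split=> //.
have dphi' := local_param_differentiable pphi' V'u'.
have [_ /(_ w)] := HA _ id dphi'.
rewrite -[id \o phi]/phi -[id \o phi']/phi' eD !deriveEjacobian //.
have [_ _ /(_ _ V'u') free _ _] := pphi'.
by move=> /(row_free_inj free) ->.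
Qed.

Lemma deriv_alongE m M (f : 'rV[R]_n -> 'rV[R]_m) V phi u w :
  local_param M V phi -> V u -> differentiable (f \o phi) u ->
  deriv_along k M f (phi u) ('D_w phi u) = 'D_w (f \o phi) u.
Proof.
move=> pphi Vu df; rewrite /deriv_along; case: xgetP => [d _|/(_ ('D_w (f \o phi) u))[]].
  move=> [V' [phi' [u' [w' [pphi' V'u' e eD <-]]]]].
  by have [] := derive_param_indep pphi' V'u' pphi Vu e df eD.
by exists V, phi, u, w.
Qed.

End ChangeOfParametrization.

(** * Symmetry of second derivatives *)

Section SymmetryOfSecondDerivatives.
Context {R : realType} {V : normedModType R}.
Implicit Types (f : V -> R) (x u v w : V).

Lemma line_is_derive f x v (s : R) :
  derivable f (x + s *: v) v ->
  is_derive s 1 (fun s => f (x + s *: v)) ('D_v f (x + s *: v)).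
Proof.
have E : (fun h : R => h^-1 *: (f (x + (h *: (1 : R) + s) *: v) - f (x + s *: v))) =
    (fun h => h^-1 *: (f (h *: v + (x + s *: v)) - f (x + s *: v))).
  apply/funext => h; congr (_ *: (f _ - _)).
  by rewrite scalerDl [h *: 1]mulr1 addrCA.
move=> df; apply: DeriveDef; first by rewrite /derivable E.
by rewrite /derive E.
Qed.

Lemma MVT_line f x v (t : R) : 0 < t ->
  (forall s, 0 <= s <= t -> derivable f (x + s *: v) v) ->
  exists2 s, 0 < s < t & f (x + t *: v) - f x = 'D_v f (x + s *: v) * t.
Proof.
move=> t0 df.
have [||s] := @MVT R (fun s => f (x + s *: v)) (fun s => 'D_v f (x + s *: v)) 0 t t0.
- move=> s; rewrite in_itv /= => /andP[s0 st].
  by apply: line_is_derive; apply: df; rewrite !ltW.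
- apply: derivable_within_continuous => s; rewrite in_itv /= => st.
  by have [] := line_is_derive (df s st).
by rewrite in_itv /= scale0r addr0 subr0 => st E; exists s.
Qed.

(** The mean value theorem is applied twice: along [v] to the difference [f (x + t *: w) - f x],
    then along [w] to ['D_v f]. *)
Lemma second_difference f u v w (t : R) : 0 < t ->
  (forall s s', 0 <= s <= t -> 0 <= s' <= t ->
    differentiable f (u + s *: v + s' *: w) /\
    differentiable ('D_v f) (u + s *: v + s' *: w)) ->
  exists s s', [/\ 0 < s < t, 0 < s' < t &
    f (u + t *: v + t *: w) - f (u + t *: v) - (f (u + t *: w) - f u) =
    'D_w ('D_v f) (u + s *: v + s' *: w) * t ^+ 2].
Proof.
move=> t0 H.
have tt : 0 <= t <= t by rewrite lexx ltW.
have zt : (0 : R) <= 0 <= t by rewrite lexx ltW.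
pose g x := f (x + t *: w) - f x.
have dshift x : differentiable f (x + t *: w) ->
    is_diff x (fun x => f (x + t *: w)) ('d f (x + t *: w)).
  move=> d; have d0 : is_diff x (fun x : V => x + t *: w) id.
    by apply: is_diff_eq; rewrite addr0.
  have := @is_diff_comp _ _ _ _ _ _ f _ x d0 (differentiableP d).
  by [].
have d1 s : 0 <= s <= t -> differentiable f (u + s *: v).
  by move=> /H/(_ zt)[]; rewrite scale0r addr0.
have dg s : 0 <= s <= t -> is_diff (u + s *: v) g
    (('d f (u + s *: v + t *: w) : V -> R) - ('d f (u + s *: v) : V -> R)).
  move=> st; have [d2 _] := H s t st tt.
  exact: (is_diffB (dshift _ d2) (differentiableP (d1 s st))).
have [s s0t E] : exists2 s, 0 < s < t & g (u + t *: v) - g u = 'D_v g (u + s *: v) * t.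
  by apply: MVT_line => // s st; apply: diff_derivable; have [] := dg s st.
have st : 0 <= s <= t by case/andP: s0t => ? ?; rewrite !ltW.
have Dg : 'D_v g (u + s *: v) = 'D_v f (u + s *: v + t *: w) - 'D_v f (u + s *: v).
  have [dg1 dg2] := dg s st; have [d2 _] := H s t st tt.
  by rewrite (deriveE _ dg1) dg2 (deriveE _ d2) (deriveE _ (d1 s st)).
have [s' s't E'] : exists2 s', 0 < s' < t &
   'D_v f (u + s *: v + t *: w) - 'D_v f (u + s *: v) =
   'D_w ('D_v f) (u + s *: v + s' *: w) * t.
  apply: (@MVT_line ('D_v f) (u + s *: v) w t t0) => r rt.
  by apply: diff_derivable; have [] := H s r st rt.
exists s, s'; split=> //.
by rewrite expr2 mulrA -E' -Dg -E /g -!addrA [u + (_ + _)]addrCA.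
Qed.

(** The double difference is symmetric in [v] and [w]. Evaluating it in both orders shows that the
    two mixed derivatives agree at two possibly different points close to [u], and continuity moves
    both to [u]. *)
Lemma derive_sym f u v w :
  (\forall z \near u, differentiable f z) ->
  (\forall z \near u, differentiable ('D_v f) z) ->
  (\forall z \near u, differentiable ('D_w f) z) ->
  {for u, continuous ('D_w ('D_v f))} -> {for u, continuous ('D_v ('D_w f))} ->
  'D_w ('D_v f) u = 'D_v ('D_w f) u.
Proof.
have comm4 (a b c d : R) : a - b - (c - d) = a - c - (b - d) by ring.
have tri (a b x e : R) : `|a - x| < e / 2 -> `|b - x| < e / 2 -> `|b - a| <= e.
  by rewrite !ltr_norml ler_norml => /andP[? ?] /andP[? ?]; lra.
have near5 (P1 P2 P3 P4 P5 : set V) : nbhs u P1 -> nbhs u P2 -> nbhs u P3 ->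
    nbhs u P4 -> nbhs u P5 -> \forall z \near u, [/\ P1 z, P2 z, P3 z, P4 z & P5 z].
  by move=> n1 n2 n3 n4 n5; near=> z; split; near: z.
move=> df dv dw cwv cvw; apply/eqP; rewrite eq_sym -subr_eq0 -normr_le0.
apply/ler_addgt0Pr => e e0; rewrite add0r.
have e20 : 0 < e / 2 by rewrite divr_gt0.
have {}cwv : \forall z \near u, `|'D_w ('D_v f) u - 'D_w ('D_v f) z| < e / 2.
  by move/cvgrPdist_lt: cwv => /(_ _ e20).
have {}cvw : \forall z \near u, `|'D_v ('D_w f) u - 'D_v ('D_w f) z| < e / 2.
  by move/cvgrPdist_lt: cvw => /(_ _ e20).
have [d d0 Hd] : exists2 d : R, 0 < d & forall z, `|u - z| < d ->
   [/\ differentiable f z, differentiable ('D_v f) z, differentiable ('D_w f) z,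
     `|'D_w ('D_v f) u - 'D_w ('D_v f) z| < e / 2 &
     `|'D_v ('D_w f) u - 'D_v ('D_w f) z| < e / 2].
  have /nbhs_ballP[d /= d0 Hd] : \forall z \near u,
   [/\ differentiable f z, differentiable ('D_v f) z, differentiable ('D_w f) z,
     `|'D_w ('D_v f) u - 'D_w ('D_v f) z| < e / 2 &
     `|'D_v ('D_w f) u - 'D_v ('D_w f) z| < e / 2].
    exact: near5 df dv dw cwv cvw.
  by exists d => // z zd; apply: Hd; rewrite -ball_normE.
have N1 : 0 < `|v| + `|w| + 1 by rewrite ltr_wpDl // addr_ge0.
(* Steps of size at most [t] along [v] and [w] stay within distance [d]; the summand 1 keeps the
   denominator positive when both directions vanish and makes the bound strict. *)
pose t := d / (`|v| + `|w| + 1).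
have t0 : 0 < t by rewrite divr_gt0.
have close s s' : 0 <= s <= t -> 0 <= s' <= t -> `|u - (u + s *: v + s' *: w)| < d.
  move=> /andP[s0 st] /andP[s'0 s't].
  rewrite -addrA opprD addNKr normrN (le_lt_trans (ler_normD _ _)) // !normrZ !ger0_norm //.
  rewrite (@le_lt_trans _ _ (t * `|v| + t * `|w|)) ?lerD ?ler_wpM2r // -mulrDr.
  by rewrite /t -mulrA mulrC gtr_pMl // mulrC ltr_pdivrMr // mul1r ltrDl.
have [s [s' [st s't E]]] : exists s s', [/\ 0 < s < t, 0 < s' < t &
    f (u + t *: v + t *: w) - f (u + t *: v) - (f (u + t *: w) - f u) =
    'D_w ('D_v f) (u + s *: v + s' *: w) * t ^+ 2].
  by apply: second_difference => // s s' st s't; have [] := Hd _ (close s s' st s't).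
have [r [r' [rt r't E']]] : exists s s', [/\ 0 < s < t, 0 < s' < t &
    f (u + t *: w + t *: v) - f (u + t *: w) - (f (u + t *: v) - f u) =
    'D_v ('D_w f) (u + s *: w + s' *: v) * t ^+ 2].
  apply: second_difference => // s1 s1' s1t s1't; rewrite addrAC.
  by have [] := Hd _ (close s1' s1 s1't s1t).
have ltle (x : R) : 0 < x < t -> 0 <= x <= t by case/andP=> ? ?; rewrite !ltW.
have [_ _ _ b1 _] := Hd _ (close s s' (ltle _ st) (ltle _ s't)).
have [_ _ _ _ b2] := Hd _ (close r' r (ltle _ r't) (ltle _ rt)).
have same : 'D_w ('D_v f) (u + s *: v + s' *: w) = 'D_v ('D_w f) (u + r' *: v + r *: w).
  have t2 : t ^+ 2 != 0 by rewrite expf_eq0 /= gt_eqF.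
  rewrite (addrAC u (r' *: v)); apply: (mulIf t2).
  apply: etrans (esym E) (etrans _ E').
  by rewrite (addrAC u (t *: w)); exact: comm4.
by apply: tri b1 _; rewrite same.
Unshelve. all: by end_near. Qed.

End SymmetryOfSecondDerivatives.

(** * Smooth scalar functions *)

Section ScalarSmoothness.
Context {R : realType} {m : nat}.
Implicit Types (U : set 'rV[R]_m) (f g : 'rV[R]_m -> R).

(** The real-valued counterpart of [Ck]: products and inverse square roots live here, and
    [Ck_coordP] passes between the two coordinate by coordinate. *)
Fixpoint Ck_scalar k U f : Prop :=
  match k with
  | 0 => forall x, U x -> {for x, continuous f}
  | k'.+1 => (forall x, U x -> differentiable f x) /\
             (forall v, Ck_scalar k' U (fun x => 'D_v f x))
  end.

Lemma Ck_scalar_congr k U f g : open U -> (forall x, U x -> f x = g x) ->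
  Ck_scalar k U f -> Ck_scalar k U g.
Proof.
move=> oU; have near_fg (h h' : 'rV[R]_m -> R) x : (forall y, U y -> h y = h' y) ->
    U x -> \forall y \near x, h y = h' y.
  by move=> hh' Ux; apply: filterS (open_nbhs_nbhs (conj oU Ux)) => y /hh'.
elim: k f g => [|k IH] f g fg /=.
  move=> H x Ux; have := H x Ux; rewrite /prop_for /continuous_at (fg _ Ux) => c.
  exact: cvg_trans (near_eq_cvg (near_fg _ _ x fg Ux)) c.
move=> [H1 H2]; split=> [x Ux|v].
  exact: near_eq_differentiable (near_fg _ _ x fg Ux) (H1 x Ux).
by apply: IH (H2 v) => x Ux; apply: near_eq_derive; exact: near_fg.
Qed.

Lemma Ck_scalarW k U f : Ck_scalar k.+1 U f -> Ck_scalar k U f.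
Proof.
elim: k f => [|k IH] f [H1 H2]; first by move=> x Ux; exact: differentiable_continuous (H1 x Ux).
by split=> // v; exact: IH.
Qed.

Lemma Ck_scalar_cst k U (c : R) : Ck_scalar k U (cst c).
Proof.
elim: k c => [|k IH] c /=; first by move=> x _; exact: cst_continuous.
split=> [x _|v]; first exact: differentiable_cst.
by under eq_fun do rewrite derive_cst; exact: IH.
Qed.

Lemma Ck_scalarD k U f g : open U ->
  Ck_scalar k U f -> Ck_scalar k U g -> Ck_scalar k U (f + g).
Proof.
move=> oU; elim: k f g => [|k IH] f g /=.
  by move=> cf cg x Ux; apply: continuousD; [exact: cf|exact: cg].
move=> [df Df] [dg Dg]; split=> [x Ux|v].
  by apply: differentiableD; [exact: df|exact: dg].
apply: Ck_scalar_congr (IH _ _ (Df v) (Dg v)) => // x Ux.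
by rewrite deriveD //; apply: diff_derivable; [exact: df|exact: dg].
Qed.

Lemma Ck_scalarM k U f g : open U ->
  Ck_scalar k U f -> Ck_scalar k U g -> Ck_scalar k U (f * g).
Proof.
move=> oU; elim: k f g => [|k IH] f g.
  by move=> cf cg x Ux; apply: continuousM; [exact: cf|exact: cg].
move=> kf kg; have [df Df] := kf; have [dg Dg] := kg; split=> [x Ux|v].
  by apply: differentiableM; [exact: df|exact: dg].
have := Ck_scalarD oU (IH _ _ (Ck_scalarW kf) (Dg v)) (IH _ _ (Ck_scalarW kg) (Df v)).
apply: Ck_scalar_congr => // x Ux.
by rewrite deriveM //; apply: diff_derivable; [exact: df|exact: dg].
Qed.

Lemma Ck_scalarN k U f : open U -> Ck_scalar k U f -> Ck_scalar k U (- f).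
Proof.
move=> oU kf; have := Ck_scalarM oU (Ck_scalar_cst k U (- 1)) kf.
by apply: Ck_scalar_congr => // x _; rewrite !fctE mulN1r.
Qed.

Lemma Ck_scalarB k U f g : open U ->
  Ck_scalar k U f -> Ck_scalar k U g -> Ck_scalar k U (f - g).
Proof. by move=> oU kf kg; apply: Ck_scalarD => //; exact: Ck_scalarN. Qed.

Lemma is_derive_rsqrt (x : R) : 0 < x ->
  is_derive x 1 (fun x => (Num.sqrt x)^-1) (- 2^-1 * (Num.sqrt x)^-1 ^+ 3).
Proof.
move=> x0; have s0 : Num.sqrt x != 0 by rewrite gt_eqF // sqrtr_gt0.
have [d e] := is_derive1_sqrt x0.
apply: DeriveDef; first exact: derivableV.
by rewrite deriveV // e /GRing.scale /=; field.
Qed.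

Lemma derive_rsqrt f x v : 0 < f x -> differentiable f x ->
  differentiable (fun y => (Num.sqrt (f y))^-1) x /\
  'D_v (fun y => (Num.sqrt (f y))^-1) x =
    - 2^-1 * (Num.sqrt (f x))^-1 ^+ 3 * 'D_v f x.
Proof.
move=> fx0 df; have [d1 d2] := is_derive_rsqrt fx0.
have d3 : differentiable (fun x : R => (Num.sqrt x)^-1) (f x) by exact/derivable1_diffP.
have d4 := differentiable_comp df d3.
split=> //; rewrite !deriveE //.
apply: etrans (congr1 (@^~ v) (diff_comp df d3)) _; rewrite /=.
by rewrite deriv1E // derive1E d2 [LHS]mulrC.
Qed.

(** The derivative is [- 1/2] times the cube of the function itself times ['D_v f], so the induction
    on [k] closes using products alone. *)
Lemma Ck_scalar_rsqrt k U f : open U -> (forall x, U x -> 0 < f x) ->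
  Ck_scalar k U f -> Ck_scalar k U (fun x => (Num.sqrt (f x))^-1).
Proof.
move=> oU f0; elim: k => [|k IH].
  move=> cf x Ux; apply: (@continuous_comp _ _ _ f (fun x => (Num.sqrt x)^-1)); first exact: cf.
  apply: differentiable_continuous; apply/derivable1_diffP.
  by have [] := is_derive_rsqrt (f0 x Ux).
move=> kf; have [df Df] := kf; have {}IH := IH (Ck_scalarW kf); split=> [x Ux|v].
  by have [] := derive_rsqrt 0 (f0 x Ux) (df x Ux).
have := Ck_scalarM oU (Ck_scalarM oU (Ck_scalar_cst k U (- 2^-1))
  (Ck_scalarM oU IH (Ck_scalarM oU IH IH))) (Df v).
apply: Ck_scalar_congr => // x Ux.
have [_ ->] := derive_rsqrt v (f0 x Ux) (df x Ux).
by rewrite !fctE /= !exprS expr0 mulr1.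
Qed.

Lemma Ck_coordP n k U (F : 'rV[R]_m -> 'rV[R]_n) : open U ->
  Ck k U F <-> forall i, Ck_scalar k U (fun x => F x 0 i).
Proof.
move=> oU; elim: k F => [|k IH] F.
  split=> [cF i x Ux|cF x Ux].
    apply: (@continuous_comp _ _ _ F (fun y : 'rV[R]_n => y 0 i)); first exact: cF.
    exact: coord_continuous.
  have -> : F = \sum_i (fun y => F y 0 i *: delta_mx 0 i).
    by apply/funext => y; rewrite fct_sumE {1}[F y]row_sum_delta.
  elim/big_ind: _ => [|f g cf cg|i _]; first exact: cst_continuous.
    exact: continuousD.
  by apply: continuousZl; exact: cF.
split=> [[dF DF] i|H].
  split=> [x Ux|v]; first by have /differentiable_rowP := dF x Ux; exact.
  have /IH/(_ i) := DF v; apply: Ck_scalar_congr => // x Ux.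
  by rewrite derive_coord //; exact: dF.
have dF x : U x -> differentiable F x.
  by move=> Ux; apply/differentiable_rowP => i; have [+ _] := H i; exact.
split=> // v; apply/IH => i; have [_ /(_ v)] := H i.
apply: Ck_scalar_congr => // x Ux.
by rewrite derive_coord //; exact: dF.
Qed.

Lemma smooth_coord n U (F : 'rV[R]_m -> 'rV[R]_n) i k : open U ->
  smooth_on U F -> Ck_scalar k U (fun x => F x 0 i).
Proof. by move=> oU /(_ k)/Ck_coordP; exact. Qed.

End ScalarSmoothness.

(** The induction closes because the derivative of [f \o l] along [v] is [('D_(l v) f) \o l], a
    composite with the same [l]. *)
Lemma Ck_scalar_lin {R : realType} m n k (l : {linear 'rV[R]_n -> 'rV[R]_m})
    (U : set 'rV[R]_m) (V : set 'rV[R]_n) f :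
  open V -> (forall x, V x -> U (l x)) ->
  Ck_scalar k U f -> Ck_scalar k V (f \o l).
Proof.
move=> oV VU; have cl := @linear_row_continuous R n _ l.
elim: k f => [|k IH] f /=.
  move=> cf x Vx; apply: continuous_comp; first exact: cl.
  by apply: cf; exact: VU.
move=> [df Df]; have dl x := @linear_differentiable _ _ _ l x cl.
split=> [x Vx|v].
  by apply: differentiable_comp => //; apply: df; exact: VU.
apply: Ck_scalar_congr (IH _ (Df (l v))) => // x Vx.
have dfx := df _ (VU _ Vx).
rewrite /= !deriveE //; last exact: differentiable_comp.
by rewrite (diff_comp (dl x) dfx) /= diff_lin.
Qed.

(** * Quaternions and octonions *)

Lemma sum_ord2 (V : zmodType) (F : 'I_2 -> V) : \sum_i F i = F 0 + F 1.
Proof.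
by rewrite !big_ord_recl big_ord0 addr0; congr (F _ + F _); exact: val_inj.
Qed.

Lemma sum_ord4 (V : zmodType) (F : 'I_4 -> V) :
  \sum_i F i = F 0 + F 1 + F 2 + F 3.
Proof.
rewrite !big_ord_recl big_ord0 addr0 !addrA.
by congr (F _ + F _ + F _ + F _); exact: val_inj.
Qed.

Lemma all_ord2 (Q : 'I_2 -> Prop) : Q 0 -> Q 1 -> forall i, Q i.
Proof.
move=> q0 q1 [[|[|//]] hi].
- by have -> : Ordinal hi = 0 by exact: val_inj.
- by have -> : Ordinal hi = 1 by exact: val_inj.
Qed.

Lemma all_ord4 (Q : 'I_4 -> Prop) : Q 0 -> Q 1 -> Q 2 -> Q 3 -> forall i, Q i.
Proof.
move=> q0 q1 q2 q3 [[|[|[|[|//]]]] hi].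
- by have -> : Ordinal hi = 0 by exact: val_inj.
- by have -> : Ordinal hi = 1 by exact: val_inj.
- by have -> : Ordinal hi = 2 by exact: val_inj.
- by have -> : Ordinal hi = 3 by exact: val_inj.
Qed.

(** Meant for triple products of basis vectors: transpositions reach every ordering of the four
    triples of distinct indices, and move a repeated index to the first two places. *)
Lemma symmetric_triples (P : 'I_4 -> 'I_4 -> 'I_4 -> Prop) :
  (forall i j k, P i j k -> P j i k) -> (forall i j k, P i j k -> P i k j) ->
  (forall i k, P i i k) -> P 1 2 3 -> P 0 2 3 -> P 0 1 3 -> P 0 1 2 ->
  forall i j k, P i j k.
Proof.
move=> s12 s23 d12.
have d13 i j : P i j i by apply: s23.
have d23 i j : P i j j by apply: s12.
have all4 := all_ord4; move: 0 1 2 3 all4 => a b c d all4 bcd acd abd abc i j k.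
move: i; apply all4; move: j; apply all4; move: k; apply all4;
  solve [ exact: d12 | exact: d23 | exact: d13 | assumption
        | apply s12; assumption | apply s23; assumption
        | apply s12; apply s23; assumption | apply s23; apply s12; assumption
        | apply s12; apply s23; apply s12; assumption ].
Qed.

Section QuaternionAlgebra.
Context {R : realType}.
Implicit Types (x y z v s e j : 'rV[R]_4).

Lemma row4P x y :
  x 0 0 = y 0 0 -> x 0 1 = y 0 1 -> x 0 2 = y 0 2 -> x 0 3 = y 0 3 -> x = y.
Proof.
by move=> h0 h1 h2 h3; apply/rowP; exact: all_ord4.
Qed.

Lemma quatE (a b c d : R) : (quat a b c d 0 0 = a) * (quat a b c d 0 1 = b) *
  (quat a b c d 0 2 = c) * (quat a b c d 0 3 = d).
Proof. by rewrite !mxE. Qed.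

Lemma dot4E x y : dot x y =
  x 0 0 * y 0 0 + x 0 1 * y 0 1 + x 0 2 * y 0 2 + x 0 3 * y 0 3.
Proof.
by rewrite /dot sum_ord4.
Qed.

Lemma addvE x y i : (x + y) 0 i = x 0 i + y 0 i. Proof. exact: mxE. Qed.
Lemma oppvE x i : (- x) 0 i = - x 0 i. Proof. exact: mxE. Qed.
Lemma scalevE (a : R) x i : (a *: x) 0 i = a * x 0 i. Proof. exact: mxE. Qed.
Lemma zerovE i : (0 : 'rV[R]_4) 0 i = 0. Proof. exact: mxE. Qed.

Lemma qmulE x y :
  (qmul x y 0 0 =
   x 0 0 * y 0 0 - x 0 1 * y 0 1 - x 0 2 * y 0 2 - x 0 3 * y 0 3) *
  (qmul x y 0 1 =
   x 0 0 * y 0 1 + x 0 1 * y 0 0 + x 0 2 * y 0 3 - x 0 3 * y 0 2) *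
  (qmul x y 0 2 =
   x 0 0 * y 0 2 - x 0 1 * y 0 3 + x 0 2 * y 0 0 + x 0 3 * y 0 1) *
  (qmul x y 0 3 =
   x 0 0 * y 0 3 + x 0 1 * y 0 2 - x 0 2 * y 0 1 + x 0 3 * y 0 0).
Proof. by rewrite /qmul !quatE. Qed.

Lemma qconjE x : (qconj x 0 0 = x 0 0) * (qconj x 0 1 = - x 0 1) *
  (qconj x 0 2 = - x 0 2) * (qconj x 0 3 = - x 0 3).
Proof. by rewrite /qconj !quatE. Qed.

Lemma quat1E : ((quat1 : 'rV[R]_4) 0 0 = 1) * ((quat1 : 'rV[R]_4) 0 1 = 0) *
  ((quat1 : 'rV[R]_4) 0 2 = 0) * ((quat1 : 'rV[R]_4) 0 3 = 0).
Proof. by rewrite /quat1 !quatE. Qed.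

Definition vE := (addvE, oppvE, scalevE, zerovE, dot4E, @qmulE, @qconjE, @quat1E).

End QuaternionAlgebra.

Ltac generalize_coords :=
  repeat match goal with
  | |- context [fun_of_matrix ?x ?i ?j] => is_var x; generalize (fun_of_matrix x i j)
  end; intros.
Ltac dot_ring := rewrite ?vE; generalize_coords; ring.
Ltac quat_ring := apply: row4P; dot_ring.

Section QuaternionIdentities.
Context {R : realType}.
Implicit Types (x y z v s e j : 'rV[R]_4).

Lemma qmulDl x y z : qmul (x + y) z = qmul x z + qmul y z.
Proof. quat_ring. Qed.

Lemma qmulDr x y z : qmul x (y + z) = qmul x y + qmul x z.
Proof. quat_ring. Qed.

Lemma qmulNl x y : qmul (- x) y = - qmul x y.
Proof. quat_ring. Qed.

Lemma qmulNr x y : qmul x (- y) = - qmul x y.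
Proof. quat_ring. Qed.

Lemma qmulZl (a : R) x y : qmul (a *: x) y = a *: qmul x y.
Proof. quat_ring. Qed.

Lemma qmulZr (a : R) x y : qmul x (a *: y) = a *: qmul x y.
Proof. quat_ring. Qed.

Lemma qconjZ (a : R) x : qconj (a *: x) = a *: qconj x.
Proof. quat_ring. Qed.

Lemma qmulA x y z : qmul x (qmul y z) = qmul (qmul x y) z.
Proof. quat_ring. Qed.

Lemma qconjD x y : qconj (x + y) = qconj x + qconj y.
Proof. quat_ring. Qed.

Lemma qconjN x : qconj (- x) = - qconj x.
Proof. quat_ring. Qed.

Lemma qconjM x y : qconj (qmul x y) = qmul (qconj y) (qconj x).
Proof. quat_ring. Qed.

Lemma qconjK x : qconj (qconj x) = x.
Proof. quat_ring. Qed.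

(** This identity and the next three polarize [conj x x = x conj x = |x|^2], with a third factor on
    either side. The octonionic polar identities reduce to them: one for the components in H, one
    for those in He, the mixed terms cancelling. *)
Lemma qmul_polarl x y z :
  qmul (qmul (qconj x) y) z + qmul (qmul (qconj y) x) z = (2 * dot x y) *: z.
Proof. quat_ring. Qed.

Lemma qmul_polarr x y z :
  qmul (qmul x (qconj y)) z + qmul (qmul y (qconj x)) z = (2 * dot x y) *: z.
Proof. quat_ring. Qed.

Lemma qmulr_polarl x y z :
  qmul (qmul z (qconj x)) y + qmul (qmul z (qconj y)) x = (2 * dot x y) *: z.
Proof. quat_ring. Qed.

Lemma qmulr_polarr x y z :
  qmul (qmul z x) (qconj y) + qmul (qmul z y) (qconj x) = (2 * dot x y) *: z.
Proof. quat_ring. Qed.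

End QuaternionIdentities.

Ltac quat_expand :=
  rewrite ?(qmulDl, qmulDr, qmulNl, qmulNr, qconjD, qconjN, qconjM, qconjK, qmulA).
Ltac row_ring :=
  apply/rowP => i; rewrite ?(addvE, oppvE, scalevE);
  repeat match goal with
  | |- context [fun_of_matrix ?x ?i ?j] => generalize (fun_of_matrix x i j)
  | |- context [dot ?x ?y] => generalize (dot x y)
  end; intros; ring.

Section RowSpans.
Context {R : realType}.

Lemma row_spanD k n (B : 'M[R]_(k, n)) x y :
  row_span B x -> row_span B y -> row_span B (x + y).
Proof. exact: addmx_sub. Qed.

Lemma row_spanZ k n (B : 'M[R]_(k, n)) (a : R) x :
  row_span B x -> row_span B (a *: x).
Proof. exact: scalemx_sub. Qed.

Lemma row_spanB k n (B : 'M[R]_(k, n)) x y :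
  row_span B x -> row_span B y -> row_span B (x - y).
Proof. by move=> Bx By; rewrite -scaleN1r; apply: row_spanD => //; exact: row_spanZ. Qed.

Lemma row_span_row k n (B : 'M[R]_(k, n)) i : row_span B (row i B).
Proof. exact: row_sub. Qed.

Lemma row_span2P n (B : 'M[R]_(2, n)) v : row_span B v <->
  exists a b : R, v = a *: row 0 B + b *: row 1 B.
Proof.
split=> [/submxP[D ->]|[a [b ->]]].
  by exists (D 0 0), (D 0 1); rewrite mulmx_sum_row sum_ord2.
by apply: row_spanD; apply: row_spanZ; exact: row_span_row.
Qed.

Lemma row_span4P n (B : 'M[R]_(4, n)) v : row_span B v <->
  exists a b c d : R,
    v = a *: row 0 B + b *: row 1 B + c *: row 2 B + d *: row 3 B.
Proof.
split=> [/submxP[D ->]|[a [b [c [d ->]]]]].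
  by exists (D 0 0), (D 0 1), (D 0 2), (D 0 3); rewrite mulmx_sum_row sum_ord4.
by do 3?[apply: row_spanD]; apply: row_spanZ; exact: row_span_row.
Qed.

Lemma row_span_ind n k (A : 'M[R]_(k, n)) (Q : 'rV[R]_n -> Prop) :
  (forall i, Q (row i A)) -> Q 0 -> (forall x y : 'rV[R]_n, Q x -> Q y -> Q (x + y)) ->
  (forall (r : R) (x : 'rV[R]_n), Q x -> Q (r *: x)) -> forall x, row_span A x -> Q x.
Proof.
move=> Qrow Q0 QD QZ x /submxP[D ->]; rewrite mulmx_sum_row.
by elim/big_ind: _ => // i _; exact: QZ.
Qed.

End RowSpans.

Section OctonionAlgebra.
Context {R : realType}.
Implicit Types (a b c d : 'rV[R]_4) (x y z t : 'rV[R]_(4 + 4)).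

Lemma oct_split x : exists a b, x = oct a b.
Proof. by exists (lsubmx x), (rsubmx x); rewrite /oct hsubmxK. Qed.

Lemma octD a b c d : oct a b + oct c d = oct (a + c) (b + d).
Proof. exact: add_row_mx. Qed.

Lemma octN a b : - oct a b = oct (- a) (- b).
Proof. exact: opp_row_mx. Qed.

Lemma octZ (r : R) a b : r *: oct a b = oct (r *: a) (r *: b).
Proof. exact: scale_row_mx. Qed.

Lemma oct_inj a b c d : oct a b = oct c d -> a = c /\ b = d.
Proof. exact: eq_row_mx. Qed.

Lemma omul_oct a b c d : omul (oct a b) (oct c d) =
  oct (qmul a c - qmul (qconj d) b) (qmul d a + qmul b (qconj c)).
Proof. by rewrite /omul /oct !row_mxKl !row_mxKr. Qed.

Lemma oconj_oct a b : oconj (oct a b) = oct (qconj a) (- b).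
Proof. by rewrite /oconj /oct row_mxKl row_mxKr. Qed.

Lemma dot_oct a b c d : dot (oct a b) (oct c d) = dot a c + dot b d.
Proof.
rewrite /dot big_split_ord /=; congr (_ + _); apply: eq_bigr => i _.
  by rewrite /oct !row_mxEl.
by rewrite /oct !row_mxEr.
Qed.

Lemma oct00 a b : oct a b 0 0 = a 0 0.
Proof.
have -> : (0 : 'I_(4 + 4)) = lshift 4 (0 : 'I_4) by exact: val_inj.
by rewrite /oct row_mxEl.
Qed.

Definition octE := (octD, octN, octZ, omul_oct, oconj_oct, dot_oct).

End OctonionAlgebra.

Ltac oct_ring :=
  repeat match goal with
  | x : matrix _ _ (4 + 4) |- _ =>
      let a := fresh "a" in let b := fresh "b" in
      move: (oct_split x) => [a [b ?]]; subst x
  end;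
  rewrite ?octE; congr (oct _ _); quat_ring.

Section OctonionIdentities.
Context {R : realType}.
Implicit Types (x y z t : 'rV[R]_(4 + 4)).
Local Notation one := (oct quat1 0 : 'rV[R]_(4 + 4)).

Lemma omulDl x y z : omul (x + y) z = omul x z + omul y z.
Proof. oct_ring. Qed.

Lemma omulDr x y z : omul x (y + z) = omul x y + omul x z.
Proof. oct_ring. Qed.

Lemma omulZl (r : R) x y : omul (r *: x) y = r *: omul x y.
Proof. oct_ring. Qed.

Lemma omulZr (r : R) x y : omul x (r *: y) = r *: omul x y.
Proof. oct_ring. Qed.

Lemma oconjD x y : oconj (x + y) = oconj x + oconj y.
Proof. oct_ring. Qed.

Lemma oconjZ (r : R) x : oconj (r *: x) = r *: oconj x.
Proof. oct_ring. Qed.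

Lemma omul1 x : omul one x = x.
Proof. oct_ring. Qed.

Lemma omulr1 x : omul x one = x.
Proof. oct_ring. Qed.

Lemma oconj1 : oconj one = one.
Proof. oct_ring. Qed.

(** The polarization of [conj x (x z) = |x|^2 z]. In the absence of associativity, this and
    [omul_polar] are the rules for exchanging factors: orthogonal ones anticommute in this sense. *)
Lemma oconj_polar x y z :
  omul (oconj x) (omul y z) + omul (oconj y) (omul x z) = (2 * dot x y) *: z.
Proof.
have [a [b ->]] := oct_split x; have [c [d ->]] := oct_split y.
have [p [q ->]] := oct_split z; rewrite ?octE mulrDr !scalerDl; congr (oct _ _).
  by rewrite -(qmul_polarl a c p) -(qmulr_polarl b d p); quat_expand; row_ring.
by rewrite -(qmulr_polarr a c q) -(qmul_polarr b d q); quat_expand; row_ring.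
Qed.

Lemma omul_polar x y z :
  omul x (omul (oconj y) z) + omul y (omul (oconj x) z) = (2 * dot x y) *: z.
Proof.
have [a [b ->]] := oct_split x; have [c [d ->]] := oct_split y.
have [p [q ->]] := oct_split z; rewrite ?octE mulrDr !scalerDl; congr (oct _ _).
  by rewrite -(qmul_polarr a c p) -(qmulr_polarl b d p); quat_expand; row_ring.
by rewrite -(qmulr_polarl a c q) -(qmul_polarr b d q); quat_expand; row_ring.
Qed.

Lemma oconj_mul_polar x y :
  omul (oconj x) y + omul (oconj y) x = (2 * dot x y) *: one.
Proof. by rewrite -(oconj_polar x y one) !omulr1. Qed.

Lemma oconj_mul_sqr x y : omul (oconj x) (omul x y) = dot x x *: y.
Proof.
apply: (@scalerI _ _ (2 : R)); first by rewrite pnatr_eq0.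
by rewrite scalerA -oconj_polar scaler_nat mulr2n.
Qed.

Lemma omul_sqr x y : omul x (omul (oconj x) y) = dot x x *: y.
Proof.
apply: (@scalerI _ _ (2 : R)); first by rewrite pnatr_eq0.
by rewrite scalerA -omul_polar scaler_nat mulr2n.
Qed.

Lemma oconj_mul_self x : omul (oconj x) x = dot x x *: one.
Proof. by rewrite -{2}(omulr1 x) oconj_mul_sqr. Qed.

End OctonionIdentities.

(** * Cayley subspaces *)

Section CayleySubspaces.
Context {R : realType}.
Implicit Types (a b c d x y z : 'rV[R]_(4 + 4)) (W : set 'rV[R]_(4 + 4)).
Local Notation one := (oct quat1 0 : 'rV[R]_(4 + 4)).

Definition real_oct x := exists r : R, x = r *: one.

Lemma oim_eq0 x : oim x = 0 <-> real_oct x.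
Proof.
split=> [/subr0_eq e|[r ->]]; first by exists (x 0 0).
rewrite /oim octZ oct00 scalevE quat1E mulr1 octZ; exact: subrr.
Qed.

Lemma real_octN x y : x + y = 0 -> real_oct x -> real_oct y.
Proof. by move=> /addr0_eq <- [r ->]; exists (- r); rewrite scaleNr. Qed.

(** For orthogonal neighbours the polar identity says that the exchange changes the sign, so reality
    is preserved. The three adjacent transpositions generate all orderings. *)
Lemma fourfold_swap12 a b c d : dot a b = 0 ->
  real_oct (fourfold a b c d) -> real_oct (fourfold b a c d).
Proof. by move=> ab; apply: real_octN; rewrite /fourfold oconj_polar ab mulr0 scale0r. Qed.

Lemma omul0 x : omul x 0 = 0.
Proof. by rewrite -(scale0r 0) omulZr !scale0r. Qed.

Lemma fourfold_swap23 a b c d : dot b c = 0 ->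
  real_oct (fourfold a b c d) -> real_oct (fourfold a c b d).
Proof.
move=> bc; apply: real_octN; have E := omul_polar b c d.
by rewrite /fourfold -(omulDr (oconj a)) E bc mulr0 scale0r omul0.
Qed.

Lemma fourfold_swap34 a b c d : dot c d = 0 ->
  real_oct (fourfold a b c d) -> real_oct (fourfold a b d c).
Proof.
move=> cd; apply: real_octN; have E := oconj_mul_polar c d.
by rewrite /fourfold -(omulDr (oconj a)) -(omulDr b) E cd mulr0 scale0r !omul0.
Qed.

Lemma dotC n (x y : 'rV[R]_n) : dot x y = dot y x.
Proof. by apply: eq_bigr => i _; rewrite mulrC. Qed.

Lemma dot_eq0 n (x : 'rV[R]_n) : dot x x = 0 -> x = 0.
Proof.
move=> /psumr_eq0P H; apply/rowP => i; rewrite mxE.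
have /eqP := H (fun i _ => sqr_ge0 (x 0 i)) i isT.
by rewrite mulf_eq0 orbb => /eqP.
Qed.

(* From [conj a (b (conj c d)) = r] and [a (conj a y) = |a|^2 y] the triple
   product [b (conj c d)] is a multiple of a. *)
Lemma triple_in_span W a b c d : a != 0 -> (forall r : R, W (r *: a)) ->
  real_oct (fourfold a b c d) -> W (omul b (omul (oconj c) d)).
Proof.
move=> a0 Wa [r E].
have na : dot a a != 0 by apply: contra_neq a0 => /dot_eq0.
have := omul_sqr a (omul b (omul (oconj c) d)).
rewrite -/(fourfold a b c d) E omulZr omulr1 => {}E.
suff -> : omul b (omul (oconj c) d) = ((dot a a)^-1 * r) *: a by exact: Wa.
by rewrite -scalerA E scalerA mulVf // scale1r.
Qed.

Section TripleClosure.
Variables (B : 'M[R]_(4, 4 + 4)).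
Let W := row_span B.
Let P x y z := W (omul x (omul (oconj y) z)).

Let P_swap12 x y z : W z -> P x y z -> P y x z.
Proof.
move=> Wz Pxyz; have E := omul_polar x y z.
rewrite /P (_ : omul y _ = (2 * dot x y) *: z - omul x (omul (oconj y) z)).
  by apply: row_spanB => //; exact: row_spanZ.
by rewrite -E addrC addKr.
Qed.

Let P_swap23 x y z : W x -> P x y z -> P x z y.
Proof.
move=> Wx Pxyz; have E := congr1 (omul x) (oconj_mul_polar y z).
rewrite omulDr omulZr omulr1 in E.
rewrite /P (_ : omul x (omul _ y) = (2 * dot y z) *: x - omul x (omul (oconj y) z)).
  by apply: row_spanB => //; exact: row_spanZ.
by rewrite -E addrC addKr.
Qed.

Let P_diag12 x z : W z -> P x x z.
Proof. by move=> Wz; rewrite /P omul_sqr; exact: row_spanZ. Qed.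

Lemma row_span_triple :
  (forall i j k, P (row i B) (row j B) (row k B)) ->
  forall x y z, W x -> W y -> W z -> P x y z.
Proof.
have W0 : W 0 by exact: sub0mx.
move=> H x y z Wx Wy Wz; rewrite /P.
pattern x; apply: row_span_ind Wx => [i||u v ? ?|r u ?] /=; last 3 first.
- by rewrite -(scale0r 0) omulZl scale0r.
- by rewrite omulDl; exact: row_spanD.
- by rewrite omulZl; exact: row_spanZ.
pattern y; apply: row_span_ind Wy => [j||u v hu hv|r u ?] /=; last 3 first.
- by rewrite -(scale0r 0) oconjZ omulZl scale0r omul0.
- rewrite (_ : omul _ _ = omul (row i B) (omul (oconj u) z) +
                           omul (row i B) (omul (oconj v) z)).
    exact: (row_spanD hu hv).
  by rewrite oconjD omulDl omulDr.
- by rewrite oconjZ omulZl omulZr; exact: row_spanZ.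
pattern z; apply: row_span_ind Wz => [k||u v ? ?|r u ?] /=; last 3 first.
- by rewrite !omul0.
- by rewrite !omulDr; exact: row_spanD.
- by rewrite !omulZr; exact: row_spanZ.
exact: H.
Qed.

(** Adjacent swaps bring each basis vector to the front of the real fourfold product; the triple
    product of the other three is then a multiple of the front one. This settles distinct indices,
    [omul_sqr] settles repeated ones, and trilinearity does the rest. *)
Lemma orthogonal_triple_closed :
  (forall i j, i != j -> dot (row i B) (row j B) = 0) ->
  (forall i, row i B != 0) ->
  oim (fourfold (row 0 B) (row 1 B) (row 2 B) (row 3 B)) = 0 ->
  forall x y z, W x -> W y -> W z -> P x y z.
Proof.
move=> orth nz /oim_eq0; have Wr i : W (row i B) by exact: row_span_row.
have span i (r : R) : W (r *: row i B) by exact: row_spanZ (Wr i).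
move=> f0123.
have f1023 := fourfold_swap12 (orth 0 1 isT) f0123.
have f1203 := fourfold_swap23 (orth 0 2 isT) f1023.
have f2103 := fourfold_swap12 (orth 1 2 isT) f1203.
have f2130 := fourfold_swap34 (orth 0 3 isT) f2103.
have f2310 := fourfold_swap23 (orth 1 3 isT) f2130.
have f3210 := fourfold_swap12 (orth 2 3 isT) f2310.
have P123 := triple_in_span (nz 0) (span 0) f0123.
have P023 := triple_in_span (nz 1) (span 1) f1023.
have P103 := triple_in_span (nz 2) (span 2) f2103.
have P210 := triple_in_span (nz 3) (span 3) f3210.
apply: row_span_triple; pose Q i j k := P (row i B) (row j B) (row k B).
have s12 i j k : Q i j k -> Q j i k by exact: P_swap12.
have s23 i j k : Q i j k -> Q i k j by exact: P_swap23.
have d12 i k : Q i i k by exact: P_diag12.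
apply: (symmetric_triples s12 s23 d12 P123 P023 (s12 1 0 3 P103)).
exact: s23 (s12 _ _ _ (s23 _ _ _ P210)).
Qed.

End TripleClosure.

Lemma cayley_triple W x y z : cayley_subspace W ->
  W x -> W y -> W z -> W (omul x (omul (oconj y) z)).
Proof.
move=> [B [orth nz ->] im0]; exact: orthogonal_triple_closed.
Qed.

Lemma cayley_subspace_mul W (j : 'rV[R]_4) z : cayley_subspace W ->
  W one -> W (oct j 0) -> W z -> W (omul (oct j 0) z).
Proof.
by move=> cW W1 Wj Wz; have := cayley_triple cW Wj W1 Wz; rewrite oconj1 omul1.
Qed.

Lemma dot_quat1 (v : 'rV[R]_4) : dot quat1 v = v 0 0.
Proof. dot_ring. Qed.

Lemma dot_quat1r (v : 'rV[R]_4) : dot v quat1 = v 0 0.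
Proof. by rewrite dotC dot_quat1. Qed.

Lemma dot0l n (v : 'rV[R]_n) : dot 0 v = 0.
Proof. by apply: big1 => i _; rewrite mxE mul0r. Qed.

Lemma dot0r n (v : 'rV[R]_n) : dot v 0 = 0.
Proof. by rewrite dotC dot0l. Qed.

Lemma dot_qmull (j v : 'rV[R]_4) : dot v (qmul j v) = j 0 0 * dot v v.
Proof. dot_ring. Qed.

Lemma dot_qmulr (j v : 'rV[R]_4) : dot v (qmul v j) = j 0 0 * dot v v.
Proof. dot_ring. Qed.

Lemma dot_qmulK (j v : 'rV[R]_4) : dot j (qmul j v) = dot j j * v 0 0.
Proof. dot_ring. Qed.

Lemma qmul00 (j v : 'rV[R]_4) : qmul j v 0 0 = 2 * (j 0 0 * v 0 0) - dot j v.
Proof. dot_ring. Qed.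

Lemma dot_qmul_qmul (x j : 'rV[R]_4) : dot (qmul x j) (qmul x j) = dot x x * dot j j.
Proof. dot_ring. Qed.

(* [T = oct v x] is imaginary and orthogonal to [J = oct j 0], hence
   [conj T (J T) = - conj J (T T) = |T|^2 conj J]. *)
Lemma cayley_complex_span (j v x : 'rV[R]_4) :
  j 0 0 = 0 -> dot j j = 1 -> v 0 0 = 0 -> dot j v = 0 -> x != 0 ->
  cayley_subspace (row_span (\matrix_(i < 4)
    [:: one; oct j 0; oct v x; oct (qmul j v) (qmul x j)]`_i)).
Proof.
move=> j0 jj v0 jv x0; set B := \matrix_(i < 4) _.
have B0 : row 0 B = one by rewrite rowK.
have B1 : row 1 B = oct j 0 by rewrite rowK.
have B2 : row 2 B = oct v x by rewrite rowK.
have B3 : row 3 B = oct (qmul j v) (qmul x j) by rewrite rowK.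
exists B.
  split=> //.
    have sym i k : dot (row i B) (row k B) = 0 -> dot (row k B) (row i B) = 0.
      by rewrite dotC.
    have d01 : dot (row 0 B) (row 1 B) = 0.
      by rewrite B0 B1 dot_oct dot_quat1 dot0l j0 addr0.
    have d02 : dot (row 0 B) (row 2 B) = 0.
      by rewrite B0 B2 dot_oct dot_quat1 dot0l v0 addr0.
    have d03 : dot (row 0 B) (row 3 B) = 0.
      by rewrite B0 B3 dot_oct dot_quat1 dot0l qmul00 v0 jv mulr0 mulr0 subr0 addr0.
    have d12 : dot (row 1 B) (row 2 B) = 0.
      by rewrite B1 B2 dot_oct dot0l jv addr0.
    have d13 : dot (row 1 B) (row 3 B) = 0.
      by rewrite B1 B3 dot_oct dot0l dot_qmulK v0 mulr0 addr0.
    have d23 : dot (row 2 B) (row 3 B) = 0.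
      by rewrite B2 B3 dot_oct dot_qmull dot_qmulr j0 !mul0r addr0.
    have d10 := sym _ _ d01; have d20 := sym _ _ d02; have d30 := sym _ _ d03.
    have d21 := sym _ _ d12; have d31 := sym _ _ d13; have d32 := sym _ _ d23.
    by apply: all_ord4; apply: all_ord4 => // /eqP.
  apply: all_ord4.
  - rewrite B0; apply/eqP => /(congr1 (fun y : 'rV[R]_(4 + 4) => y 0 0)) /eqP.
    by rewrite oct00 quat1E mxE oner_eq0.
  - rewrite B1; apply/eqP; rewrite -(row_mx0 R 1 4 4) => /oct_inj[je _].
    by move: jj; rewrite je dot0l => /eqP; rewrite eq_sym oner_eq0.
  - by rewrite B2; apply: contra_neq x0; rewrite -(row_mx0 R 1 4 4) => /oct_inj[].
  - rewrite B3; apply: contra_neq x0; rewrite -(row_mx0 R 1 4 4) => /oct_inj[_ e].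
    by apply: dot_eq0; rewrite -[LHS]mulr1 -jj -dot_qmul_qmul e dot0l.
rewrite B0 B1 B2 B3; apply/oim_eq0; rewrite /fourfold.
pose J := oct j 0; pose T := oct v x.
have -> : oct (qmul j v) (qmul x j) = omul J T.
  by rewrite /J /T omul_oct; congr oct; quat_ring.
have JT : dot T J = 0 by rewrite dot_oct dotC jv dot0r addr0.
have TN : oconj T = - T.
  rewrite /T oconj_oct octN; congr oct; apply: row4P; by rewrite ?vE ?v0 ?oppr0.
have TT : omul T T = - (dot T T *: one).
  by rewrite -oconj_mul_self TN -(scaleN1r T) omulZl scaleN1r opprK.
have TJT : omul (oconj T) (omul J T) = dot T T *: oconj J.
  have := oconj_polar T J T; rewrite JT mulr0 scale0r TT => /eqP.
  rewrite addr_eq0 => /eqP ->.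
  by rewrite -(scaleN1r (_ *: _)) !omulZr omulr1 scaleN1r opprK.
(* The fourfold product of 1, J, T, J T has become [|T|^2] times [J (conj J)], which is real. *)
rewrite oconj1 omul1 TJT omulZr -(omulr1 (oconj J)) omul_sqr scalerA.
by eexists.
Qed.

End CayleySubspaces.

(** * Oriented surfaces in R^4 *)

Section DotProduct.
Context {R : realType} {n : nat}.
Implicit Types (x y z : 'rV[R]_n) (a : R).

Lemma dotDl x y z : dot (x + y) z = dot x z + dot y z.
Proof. by rewrite /dot -big_split; apply: eq_bigr => i _; rewrite mxE mulrDl. Qed.

Lemma dotDr x y z : dot x (y + z) = dot x y + dot x z.
Proof. by rewrite !(dotC x) dotDl. Qed.

Lemma dotZl a x y : dot (a *: x) y = a * dot x y.
Proof. by rewrite /dot mulr_sumr; apply: eq_bigr => i _; rewrite mxE mulrA. Qed.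

Lemma dotZr a x y : dot x (a *: y) = a * dot x y.
Proof. by rewrite !(dotC x) dotZl. Qed.

Lemma dotNl x y : dot (- x) y = - dot x y.
Proof. by rewrite -scaleN1r dotZl mulN1r. Qed.

Lemma dotNr x y : dot x (- y) = - dot x y.
Proof. by rewrite !(dotC x) dotNl. Qed.

Lemma dot_ge0 x : 0 <= dot x x.
Proof. by apply: sumr_ge0 => i _; exact: sqr_ge0. Qed.

Lemma dot_gt0 x : x != 0 -> 0 < dot x x.
Proof. by move=> x0; rewrite lt_def dot_ge0 andbT; apply: contra_neq x0 => /dot_eq0. Qed.

Lemma orth_projE (S : set 'rV[R]_n) z w : orthogonal_space S w ->
  orthogonal_space (orthogonal_space S) (z - w) ->
  orth_proj (orthogonal_space S) z = w.
Proof.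
move=> Sw zw; rewrite /orth_proj; case: xgetP => [w' _ [Sw' zw']|/(_ w)[]//].
have Sd : orthogonal_space S (w' - w).
  by move=> s Ss; rewrite dotDl dotNl Sw' // Sw // subrr.
apply/subr0_eq/dot_eq0.
have {1}-> : w' - w = (z - w) - (z - w') by rewrite opprB [RHS]addrC subrKA.
by rewrite dotDl dotNl zw // zw' // subrr.
Qed.

Lemma orthonormal_rows2P (E : 'M[R]_(2, n)) : orthonormal_rows E <->
  [/\ dot (row 0 E) (row 0 E) = 1, dot (row 1 E) (row 1 E) = 1
    & dot (row 0 E) (row 1 E) = 0].
Proof.
split=> [H|[h00 h11 h01]]; first by split; rewrite H.
by rewrite /orthonormal_rows; apply: all_ord2; apply: all_ord2; rewrite // dotC.
Qed.

Lemma row_mulmx2 (A : 'M[R]_2) (E : 'M[R]_(2, n)) i :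
  row i (A *m E) = A i 0 *: row 0 E + A i 1 *: row 1 E.
Proof. by rewrite row_mul mulmx_sum_row sum_ord2 !mxE. Qed.

Definition gram2 x y := dot x x * dot y y - dot x y ^+ 2.

Lemma gram2_gt0 (T : 'M[R]_(2, n)) : row_free T -> 0 < gram2 (row 0 T) (row 1 T).
Proof.
move=> fT; set x := row 0 T; set y := row 1 T.
have lin (a b : R) : a *: x + b *: y = 0 -> a = 0 /\ b = 0.
  move=> e; pose D : 'rV[R]_2 := \row_i (if i == 0 then a else b).
  have D0 : D = 0.
    apply: (row_free_inj fT); rewrite mul0mx mulmx_sum_row sum_ord2.
    by rewrite !mxE.
  have := congr1 (fun v : 'rV[R]_2 => v 0 0) D0.
  have := congr1 (fun v : 'rV[R]_2 => v 0 1) D0.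
  by rewrite !mxE.
have x0 : x != 0.
  apply/eqP => x0; have [] := lin 1 0; first by rewrite x0 scaler0 scale0r addr0.
  by move=> /eqP; rewrite oner_eq0.
have xx := dot_gt0 x0.
(* This vector is the component of [y] orthogonal to [x], scaled by [|x|^2]; its squared length is
   [|x|^2] times the Gram determinant. *)
have w0 : dot x x *: y - dot x y *: x != 0.
  apply/eqP => w0; have [] := lin (- dot x y) (dot x x).
    by rewrite scaleNr addrC.
  by move=> _ /eqP; rewrite gt_eqF.
rewrite -(pmulr_rgt0 _ xx); have := dot_gt0 w0.
rewrite !(dotDl, dotDr, dotNl, dotNr, dotZl, dotZr) (dotC y x) /gram2.
by congr (0 < _); ring.
Qed.

End DotProduct.

Lemma det_mx2 {R : realType} (A : 'M[R]_2) : \det A = A 0 0 * A 1 1 - A 0 1 * A 1 0.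
Proof.
rewrite (expand_det_row A 0) sum_ord2 /cofactor !det_mx11 !mxE /= expr0 expr1.
rewrite mul1r mulN1r mulrN; congr (_ * A _ _ - _ * A _ _); exact: val_inj.
Qed.

Lemma gram_schmidt2 {R : realType} n (T : 'M[R]_(2, n)) : row_free T ->
  exists A : 'M[R]_2, 0 < \det A /\ orthonormal_rows (A *m T).
Proof.
move=> fT; have G0 := gram2_gt0 fT.
set x := row 0 T in G0; set y := row 1 T in G0.
have xx : 0 < dot x x.
  rewrite lt_def dot_ge0 andbT; apply/eqP => xx; move: G0.
  by rewrite /gram2 xx (dot_eq0 xx) dot0l mul0r expr0n subrr ltxx.
(* [h] normalizes [x], and [k] normalizes [|x|^2 y - <x, y> x]. The matrix below is triangular with
   positive diagonal [h], [k |x|^2], hence preserves orientation. *)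
pose h := (Num.sqrt (dot x x))^-1; pose k := (Num.sqrt (dot x x * gram2 x y))^-1.
have h0 : 0 < h by rewrite invr_gt0 sqrtr_gt0.
have k0 : 0 < k by rewrite invr_gt0 sqrtr_gt0 mulr_gt0.
have hh : h ^+ 2 * dot x x = 1.
  by rewrite exprVn sqr_sqrtr ?mulVf ?gt_eqF // ltW.
have kk : k ^+ 2 * (dot x x * gram2 x y) = 1.
  by rewrite exprVn sqr_sqrtr ?mulVf ?gt_eqF ?mulr_gt0 // ltW // mulr_gt0.
exists (\matrix_(i, j) (if i == 0 then (if j == 0 then h else 0) else
                        (if j == 0 then - (k * dot x y) else k * dot x x))).
rewrite det_mx2 !mxE /= mul0r subr0; split; first by rewrite !mulr_gt0.
apply/orthonormal_rows2P; rewrite !row_mulmx2 !mxE /= -/x -/y.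
rewrite !(dotDl, dotDr, dotNl, dotNr, dotZl, dotZr) (dotC y x); split.
- by rewrite -[RHS]hh; ring.
- by rewrite -[RHS]kk /gram2; ring.
- by ring.
Qed.

(** * Triple products of imaginary quaternions and the projection away from 1 and j *)

Section ImaginaryQuaternions.
Context {R : realType}.
Implicit Types (j v w s t : 'rV[R]_4).

Lemma quat_eta v : v = quat (v 0 0) (v 0 1) (v 0 2) (v 0 3).
Proof. by apply: row4P; rewrite quatE. Qed.

(** The determinant is the scalar triple product of three imaginary quaternions, so the orientation
    condition in [Jminus] becomes the sign of a pairing with [qmul j v]. *)
Lemma det_quat j v w : j 0 0 = 0 -> v 0 0 = 0 -> w 0 0 = 0 ->
  \det (\matrix_(i < 4) [:: quat1; j; v; w]`_i) = dot (qmul j v) w.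
Proof.
move=> j0 v0 w0; rewrite !vE j0 v0 w0.
rewrite (quat_eta j) (quat_eta v) (quat_eta w) !quatE j0 v0 w0.
move: (j 0 1) (j 0 2) (j 0 3) (v 0 1) (v 0 2) (v 0 3) (w 0 1) (w 0 2) (w 0 3).
move=> j1 j2 j3 v1 v2 v3 w1 w2 w3.
rewrite (expand_det_row _ 0) sum_ord4 !mxE /= !mul0r !addr0 mul1r.
rewrite /cofactor expr0 mul1r (expand_det_row _ 0) !big_ord_recl big_ord0.
rewrite /cofactor !det_mx2 !mxE /=.
ring.
Qed.

(* Both sides are the Gram determinant of j, v, w. *)
Lemma triple_product_sqr j v w : j 0 0 = 0 -> v 0 0 = 0 -> w 0 0 = 0 ->
  dot j v = 0 -> dot j w = 0 -> dot v w = 0 ->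
  dot (qmul j v) w ^+ 2 = dot j j * dot v v * dot w w.
Proof.
move=> j0 v0 w0 jv jw vw.
have -> : dot j j * dot v v * dot w w = dot j j * dot v v * dot w w +
    2 * dot j v * dot v w * dot j w - dot j j * dot v w ^+ 2 -
    dot v v * dot j w ^+ 2 - dot w w * dot j v ^+ 2.
  by rewrite jv jw vw; ring.
rewrite !vE j0 v0 w0; generalize_coords; ring.
Qed.

Lemma qmul_unit_imag j v : j 0 0 = 0 -> dot j j = 1 -> qmul j (qmul j v) = - v.
Proof.
move=> j0 jj; have -> : - v = - (dot j j *: v) by rewrite jj scale1r.
by apply: row4P; rewrite ?vE j0; generalize_coords; ring.
Qed.

(** For a unit imaginary [j] this is the orthogonal projection onto the complement of 1 and [j]. The
    explicit formula is linear in [s] for every [j]. *)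
Definition proj_minus (j s : 'rV[R]_4) := s - s 0 0 *: quat1 - dot j s *: j.

Lemma proj_minusD j s t : proj_minus j (s + t) = proj_minus j s + proj_minus j t.
Proof. by rewrite /proj_minus addvE dotDr; row_ring. Qed.

Lemma proj_minusZ j (a : R) s : proj_minus j (a *: s) = a *: proj_minus j s.
Proof. by rewrite /proj_minus scalevE dotZr; row_ring. Qed.

Lemma proj_minusN j s : proj_minus j (- s) = - proj_minus j s.
Proof. by rewrite -(scaleN1r s) proj_minusZ scaleN1r. Qed.

Lemma proj_minus_kill j (a b : R) : j 0 0 = 0 -> dot j j = 1 ->
  proj_minus j (a *: quat1 + b *: j) = 0.
Proof.
move=> j0 jj; rewrite /proj_minus dotDr !dotZr dot_quat1r jj !vE j0.
by apply/rowP => i; rewrite ?(addvE, oppvE, scalevE) [RHS]mxE; ring.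
Qed.

(** Left multiplication by a unit imaginary [j] is an isometry preserving the span of 1 and [j],
    hence also its complement. *)
Lemma proj_minus_qmul j s : j 0 0 = 0 -> dot j j = 1 ->
  proj_minus j (qmul j s) = qmul j (proj_minus j s).
Proof.
move=> j0 jj; rewrite /proj_minus qmul00 dot_qmulK jj j0 mul0r mulr0 sub0r mul1r.
have q1 : qmul j quat1 = j by quat_ring.
have jq : qmul j j = - quat1 by rewrite -{2}q1 qmul_unit_imag.
rewrite !(qmulDr, qmulNr, qmulZr) q1 jq.
move: (qmul j s) (dot j s) => q d; row_ring.
Qed.

End ImaginaryQuaternions.

Section OrientedSurface.
Context {R : realType}.
Variables (L : set 'rV[R]_4) (or : 'rV[R]_4 -> 'M[R]_(2, 4) -> Prop).
Hypothesis L_oriented : orientation L or.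
Implicit Types (p X s v : 'rV[R]_4) (E T : 'M[R]_(2, 4)).

Lemma oriented_in p E : or p E -> L p.
Proof. by have [H _ _] := L_oriented; move=> /H[]. Qed.

Lemma oriented_span p E : or p E -> tangent_space 2 L p = row_span E.
Proof. by have [H _ _] := L_oriented; move=> /H[]. Qed.

Lemma oriented_free p E : or p E -> row_free E.
Proof. by have [H _ _] := L_oriented; move=> /H[]. Qed.

Lemma oriented_det p E (A : 'M[R]_2) : or p E -> or p (A *m E) <-> 0 < \det A.
Proof. by have [_ + _] := L_oriented; exact. Qed.

Lemma oriented_change p E T : or p E -> or p T ->
  exists2 A : 'M[R]_2, T = A *m E & 0 < \det A.
Proof.
move=> oE oT.
have /submxP[A TE] : (T <= E)%MS.
  apply/row_subP => i; have : row_span T (row i T) by exact: row_span_row.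
  by rewrite -(oriented_span oT) (oriented_span oE).
by exists A => //; apply/(oriented_det A oE); rewrite -TE.
Qed.

Lemma oframeP p : L p -> or p (oframe or p) /\ orthonormal_rows (oframe or p).
Proof.
have [_ _ H] := L_oriented; move=> /H[V [phi [u [_ Vu <- oJ]]]].
have oT := oJ u Vu; have [A [detA EA]] := gram_schmidt2 (oriented_free oT).
rewrite /oframe; case: xgetP => [E _ [] //|/(_ (A *m jacobian phi u))[]].
by split=> //; apply/oriented_det.
Qed.

(** The imaginary part of [- conj y x]: the alternating bilinear extension to arbitrary pairs of the
    formula that gives [jL] on orthonormal frames. *)
Definition wedge (x y : 'rV[R]_4) := - qmul (qconj y) x + dot x y *: quat1.

Lemma jLE p : jL or p = - qmul (qconj (row 1 (oframe or p))) (row 0 (oframe or p)).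
Proof.
rewrite /jL omul_oct /oct row_mxKl; quat_ring.
Qed.

(** Both expressions are alternating in the frame, so passing from [oframe] to [T = A *m oframe]
    multiplies them by [\det A], which is positive and thus the square root of the Gram determinant
    of [T]. This trades the arbitrary [oframe] for any oriented frame, in particular a smooth
    one. *)
Lemma oframe_change p T : or p T ->
  let h := (Num.sqrt (gram2 (row 0 T) (row 1 T)))^-1 in
  [/\ 0 < gram2 (row 0 T) (row 1 T),
      jL or p = h *: wedge (row 0 T) (row 1 T)
    & forall X, JL or p X =
        h *: (dot X (row 0 T) *: row 1 T - dot X (row 1 T) *: row 0 T)].
Proof.
move=> oT h; have G0 := gram2_gt0 (oriented_free oT).
have [oE /orthonormal_rows2P[]] := oframeP (oriented_in oT).
have [A TE detA] := oriented_change oE oT.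
rewrite det_mx2 in detA.
move: G0; rewrite {}/h TE !row_mulmx2 jLE /JL.
set e1 := row 0 _; set e2 := row 1 _.
move: (A 0 0) (A 0 1) (A 1 0) (A 1 1) detA => a b c d detA G0 e11 e22 e12.
set h := (Num.sqrt _)^-1.
have GE : gram2 (a *: e1 + b *: e2) (c *: e1 + d *: e2) = (a * d - b * c) ^+ 2.
  rewrite /gram2 !(dotDl, dotDr, dotZl, dotZr) (dotC e2 e1) e11 e22 e12; ring.
have hE : h = (a * d - b * c)^-1.
  by rewrite /h GE sqrtr_sqr ger0_norm // ltW.
have dn : a * d - b * c != 0 by rewrite gt_eqF.
split=> //.
  rewrite hE; apply: (scalerI dn); rewrite scalerA mulfV // scale1r.
  have -> : wedge (a *: e1 + b *: e2) (c *: e1 + d *: e2) =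
    (a * d - b * c) *: (- qmul (qconj e2) e1 + dot e1 e2 *: quat1).
    by rewrite /wedge; quat_ring.
  by rewrite e12 scale0r addr0.
move=> X; rewrite hE; apply: (scalerI dn); rewrite scalerA mulfV // scale1r.
rewrite !(dotDr, dotZr); move: (dot X e1) (dot X e2) => r q.
by row_ring.
Qed.

Lemma oriented_orthonormal p E : or p E -> orthonormal_rows E ->
  jL or p = - qmul (qconj (row 1 E)) (row 0 E) /\
  forall X, JL or p X = dot X (row 0 E) *: row 1 E - dot X (row 1 E) *: row 0 E.
Proof.
move=> oE /orthonormal_rows2P[e1 e2 e12]; have [_ -> JE] := oframe_change oE.
have g1 : (Num.sqrt (gram2 (row 0 E) (row 1 E)))^-1 = 1.
  by rewrite /gram2 e1 e2 e12 expr0n subr0 mulr1 sqrtr1 invr1.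
split; first by rewrite g1 scale1r /wedge e12 scale0r addr0.
by move=> X; rewrite JE g1 scale1r.
Qed.

Lemma jL00 p : L p -> jL or p 0 0 = 0.
Proof.
move=> /oframeP[_ /orthonormal_rows2P[_ _ e12]]; rewrite jLE.
move: (row 0 _) (row 1 _) e12 => x y xy.
have -> : (- qmul (qconj y) x) 0 0 = - dot x y by dot_ring.
by rewrite xy oppr0.
Qed.

Lemma dot_jL p : L p -> dot (jL or p) (jL or p) = 1.
Proof.
move=> /oframeP[_ /orthonormal_rows2P[e1 e2 _]]; rewrite jLE dotNl dotNr opprK.
rewrite dot_qmul_qmul e1 mulr1 -e2; move: (row 1 _) => x; dot_ring.
Qed.

Lemma VminusP p s : Vminus or p s <-> s 0 0 = 0 /\ dot (jL or p) s = 0.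
Proof.
split=> [H|[s0 sj] w [a [b ->]]]; last first.
  by rewrite dotDr !dotZr dot_quat1r s0 (dotC s) sj !mulr0 addr0.
split; first by rewrite -dot_quat1 dotC; apply: H; exists 1, 0; rewrite scale1r scale0r addr0.
by rewrite dotC; apply: H; exists 0, 1; rewrite scale1r scale0r add0r.
Qed.

Lemma orth_proj_Vminus p s : L p ->
  orth_proj (Vminus or p) s = proj_minus (jL or p) s.
Proof.
move=> Lp; have j0 := jL00 Lp; have jj := dot_jL Lp.
apply: orth_projE => [|v Vv].
  apply/VminusP; split; first by rewrite /proj_minus ?vE j0; ring.
  rewrite /proj_minus !(dotDr, dotNr, dotZr) dot_quat1r jj j0; ring.
have /VminusP[v0 jv] : Vminus or p v by [].
have -> : s - proj_minus (jL or p) s = s 0 0 *: quat1 + dot (jL or p) s *: jL or p.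
  by rewrite /proj_minus -addrA -opprD opprB addrC subrK.
by rewrite dotDl !dotZl dot_quat1 v0 jv !mulr0 addr0.
Qed.

Lemma Vminus_qmul p v : L p -> Vminus or p v -> Vminus or p (qmul (jL or p) v).
Proof.
move=> Lp /VminusP[v0 jv]; apply/VminusP; split.
  by rewrite qmul00 v0 jv !mulr0 subr0.
by rewrite dot_qmulK v0 mulr0.
Qed.

(** By [triple_product_sqr] an admissible [w] pairs with [j v] to plus or minus [|v|^2]. With plus,
    [|w - j v|^2] vanishes; with minus, the determinant is [- |v|^2], and its nonnegativity forces
    [v = 0]. *)
Lemma JminusE p v : L p -> Vminus or p v -> Jminus or p v = qmul (jL or p) v.
Proof.
move=> Lp Vv; have j0 := jL00 Lp; have jj := dot_jL Lp.
have /VminusP[v0 jv] := Vv; set j := jL or p.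
have n1 : dot (qmul j v) (qmul j v) = dot v v by rewrite dot_qmul_qmul jj mul1r.
rewrite /Jminus; case: xgetP => [w _|/(_ (qmul j v))[]]; last first.
  split; [exact: Vminus_qmul|exact: n1|by rewrite dot_qmull j0 mul0r|].
  have jv0 : qmul j v 0 0 = 0 by rewrite qmul00 v0 jv !mulr0 subr0.
  by rewrite det_quat //; exact: dot_ge0.
move=> [/VminusP[w0 jw] ww vw].
set M := \matrix_(i < 4) _.
have dM : \det M = dot (qmul j v) w by exact: det_quat.
have : \det M ^+ 2 = dot v v ^+ 2.
  by rewrite dM triple_product_sqr // jj ww mul1r expr2.
move=> /eqP; rewrite eqf_sqr dM => /orP[/eqP e _|/eqP -> v_le0]; last first.
  have v00 : v = 0.
    by apply/dot_eq0/eqP; rewrite eq_le dot_ge0 andbT -oppr_ge0.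
  have -> : w = 0 by apply: dot_eq0; rewrite ww v00 dot0l.
  by rewrite v00; quat_ring.
apply/subr0_eq/dot_eq0.
by rewrite !(dotDl, dotDr, dotNl, dotNr) (dotC w) e ww n1; ring.
Qed.

End OrientedSurface.

(** * Bilinear maps of smooth functions *)

Section BilinearCalculus.
Context {R : realType}.

Definition bilinear_fun (V1 V2 W : lmodType R) (b : V1 -> V2 -> W) :=
  (forall y a x x', b (a *: x + x') y = a *: b x y + b x' y) /\
  (forall x a y y', b x (a *: y + y') = a *: b x y + b x y').

Lemma bilinear_fun_sum n m (W : lmodType R) (b : 'rV[R]_n -> 'rV[R]_m -> W) :
  bilinear_fun b -> forall x y, b x y =
    \sum_i \sum_j (x 0 i * y 0 j) *: b (delta_mx 0 i) (delta_mx 0 j).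
Proof.
move=> [bl br] x y.
have sum_lin (U : lmodType R) k (l : 'rV[R]_k -> U) :
    (forall a z z', l (a *: z + z') = a *: l z + l z') ->
    forall z, l z = \sum_i z 0 i *: l (delta_mx 0 i).
  move=> lin z; have l0 : l 0 = 0.
    by have := lin (- 1) 0 0; rewrite scaler0 addr0 scaleN1r addNr.
  rewrite {1}[z]row_sum_delta; elim/big_rec2: _ => // i u v _ <-.
  exact: lin.
rewrite (sum_lin _ _ (b^~ y)) => [|a z z']; last exact: bl.
apply: eq_bigr => i _; rewrite (sum_lin _ _ (b _)) => [|a z z']; last exact: br.
by rewrite scaler_sumr; apply: eq_bigr => j _; rewrite scalerA.
Qed.

Context {V : normedModType R}.

Lemma deriveZl (W : normedModType R) (k : V -> R) (c : W) x v :
  differentiable k x -> 'D_v (fun z => k z *: c) x = 'D_v k x *: c.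
Proof.
move=> dk; rewrite !deriveE //; first by rewrite diffZl.
exact: differentiableZl.
Qed.

Lemma derive_bilinear n m (W : normedModType R) (b : 'rV[R]_n -> 'rV[R]_m -> W)
    (f : V -> 'rV[R]_n) (g : V -> 'rV[R]_m) x v :
  bilinear_fun b -> differentiable f x -> differentiable g x ->
  differentiable (fun z => b (f z) (g z)) x /\
  'D_v (fun z => b (f z) (g z)) x = b ('D_v f x) (g x) + b (f x) ('D_v g x).
Proof.
move=> bb df dg; have bE := bilinear_fun_sum bb.
pose F i j z := (f z 0 i * g z 0 j) *: b (delta_mx 0 i) (delta_mx 0 j).
have E : (fun z => b (f z) (g z)) = \sum_i \sum_j F i j.
  apply/funext => z; rewrite bE fct_sumE; apply: eq_bigr => i _.
  by rewrite fct_sumE.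
have df_ i : differentiable (fun z => f z 0 i) x by move: i; apply/differentiable_rowP.
have dg_ j : differentiable (fun z => g z 0 j) x by move: j; apply/differentiable_rowP.
have dfg i j : differentiable (fun z => f z 0 i * g z 0 j) x by exact: differentiableM.
have dF i j : differentiable (F i j) x by exact: differentiableZl.
have dsF i : differentiable (\sum_j F i j) x by exact: differentiable_sum.
rewrite E; split; first exact: differentiable_sum.
rewrite derive_sum => [|i]; last exact: diff_derivable.
rewrite !bE -big_split; apply: eq_bigr => i _ /=.
rewrite derive_sum => [|j]; last exact: diff_derivable.
rewrite -big_split; apply: eq_bigr => j _ /=.
rewrite /F deriveZl // deriveM; [|exact: diff_derivable..].
by rewrite !derive_coord // -scalerDl; congr (_ *: _); rewrite addrC [_ *: _]mulrC.
Qed.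

Lemma derive_scale n (a : V -> R) (f : V -> 'rV[R]_n) x v :
  differentiable a x -> differentiable f x ->
  differentiable (fun z => a z *: f z) x /\
  'D_v (fun z => a z *: f z) x = 'D_v a x *: f x + a x *: 'D_v f x.
Proof.
move=> da df.
have df_ i : differentiable (fun z => f z 0 i) x by move: i; apply/differentiable_rowP.
have E i : (fun z => (a z *: f z) 0 i) = a * (fun z => f z 0 i).
  by apply/funext => z; rewrite !mxE.
have d : differentiable (fun z => a z *: f z) x.
  by apply/differentiable_rowP => i; rewrite E; exact: differentiableM.
split=> //; apply/rowP => i.
rewrite derive_coord // E deriveM; [|exact: diff_derivable..].
rewrite [RHS]mxE [X in _ = X + _]mxE [X in _ = _ + X]mxE derive_coord //.
by rewrite addrC [f x 0 i *: _]mulrC.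
Qed.

Lemma bilinear_dot n : bilinear_fun (@dot R n : _ -> _ -> R^o).
Proof.
by split=> *; rewrite ?dotDl ?dotDr ?dotZl ?dotZr.
Qed.

Lemma bilinear_wedge : bilinear_fun (@wedge R).
Proof.
split=> [y a x x'|x a y y']; rewrite /wedge.
  rewrite dotDl dotZl qmulDr qmulZr; move: (qmul _ x) (qmul _ x') => q q'.
  by move: (dot x y) (dot x' y) => d d'; row_ring.
rewrite dotDr dotZr qconjD qconjZ qmulDl qmulZl; move: (qmul _ x) (qmul _ x) => q q'.
by move: (dot x y) (dot x y') => d d'; row_ring.
Qed.

Lemma derive_dot n (f g : V -> 'rV[R]_n) x v :
  differentiable f x -> differentiable g x ->
  differentiable (fun z => dot (f z) (g z)) x /\
  'D_v (fun z => dot (f z) (g z)) x = dot ('D_v f x) (g x) + dot (f x) ('D_v g x).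
Proof. exact: (derive_bilinear v (@bilinear_dot n)). Qed.

Lemma differentiable_dot n (f g : V -> 'rV[R]_n) x :
  differentiable f x -> differentiable g x ->
  differentiable (fun z => dot (f z) (g z)) x.
Proof. by move=> df dg; have [] := derive_dot 0 df dg. Qed.

Lemma differentiable_scale n (a : V -> R) (f : V -> 'rV[R]_n) x :
  differentiable a x -> differentiable f x ->
  differentiable (fun z => a z *: f z) x.
Proof. by move=> da df; have [] := derive_scale 0 da df. Qed.

Lemma differentiable_gram2 n (f g : V -> 'rV[R]_n) x :
  differentiable f x -> differentiable g x ->
  differentiable (fun z => gram2 (f z) (g z)) x.
Proof.
move=> df dg; rewrite /gram2; apply: differentiableB; first apply: differentiableM.
- exact: differentiable_dot.
- exact: differentiable_dot.
- under eq_fun do rewrite expr2.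
  by apply: differentiableM; exact: differentiable_dot.
Qed.

End BilinearCalculus.

Section BilinearSmoothness.
Context {R : realType} {m : nat}.
Implicit Types (U : set 'rV[R]_m).

Lemma Ck_scalar_bilinear n l k U (b : 'rV[R]_n -> 'rV[R]_l -> R^o) f g :
  open U -> bilinear_fun b -> Ck k U f -> Ck k U g ->
  Ck_scalar k U (fun z => b (f z) (g z)).
Proof.
move=> oU bb /Ck_coordP-/(_ oU) kf /Ck_coordP-/(_ oU) kg.
have sum_Ck j (F : 'I_j -> 'rV[R]_m -> R) : (forall i, Ck_scalar k U (F i)) ->
    Ck_scalar k U (\sum_i F i).
  move=> kF; elim/big_ind: _ => // [|F1 F2]; first exact: Ck_scalar_cst.
  exact: Ck_scalarD.
pose F i j := (fun z => f z 0 i) * (fun z => g z 0 j) *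
              cst (b (delta_mx 0 i) (delta_mx 0 j)) : 'rV[R]_m -> R.
have -> : (fun z => b (f z) (g z)) = \sum_i \sum_j F i j.
  apply/funext => z; rewrite (bilinear_fun_sum bb) fct_sumE; apply: eq_bigr => i _.
  by rewrite fct_sumE.
apply: (sum_Ck) => i; apply: (sum_Ck) => j.
by apply: Ck_scalarM => //; [exact: Ck_scalarM|exact: Ck_scalar_cst].
Qed.

Lemma Ck_scalar_gram2 n k U (f g : 'rV[R]_m -> 'rV[R]_n) : open U ->
  Ck k U f -> Ck k U g -> Ck_scalar k U (fun z => gram2 (f z) (g z)).
Proof.
move=> oU kf kg; have kdot f1 g1 := @Ck_scalar_bilinear _ _ k U _ f1 g1 oU (@bilinear_dot R n).
have := Ck_scalarB oU (Ck_scalarM oU (kdot _ _ kf kf) (kdot _ _ kg kg))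
  (Ck_scalarM oU (kdot _ _ kf kg) (kdot _ _ kf kg)).
by apply: Ck_scalar_congr => // z _; rewrite /gram2 expr2.
Qed.

End BilinearSmoothness.

(** * Normal curvature *)

Lemma gram2_orthonormal {R : realType} n (x y : 'rV[R]_n) :
  dot x x = 1 -> dot y y = 1 -> dot x y = 0 -> gram2 x y = 1.
Proof. by move=> xx yy xy; rewrite /gram2 xx yy xy expr0n subr0 mulr1. Qed.

Section SecondFundamentalForm.
Context {R : realType}.
Variables (L : set 'rV[R]_4) (or : 'rV[R]_4 -> 'M[R]_(2, 4) -> Prop).
Hypothesis L_oriented : orientation L or.
Implicit Types (p X nu : 'rV[R]_4) (E T : 'M[R]_(2, 4)).

(** [W] is the constant change of basis from the coordinate frame at [p] to [E]. Its determinant is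
    positive, so the frame stays oriented on all of [V], though it is [E] only at [p]. *)
Lemma adapted_param p E : or p E ->
  exists (V : set 'rV[R]_2) phi u (W : 'M[R]_2),
    [/\ local_param L V phi, V u, phi u = p, W *m jacobian phi u = E
      & forall z, V z -> or (phi z) (W *m jacobian phi z)].
Proof.
move=> oE; have Lp := oriented_in L_oriented oE.
have [_ _ /(_ p Lp)] := L_oriented.
move=> [V [phi [u [pphi Vu phiu oJ]]]]; have := oJ u Vu; rewrite phiu => oJu.
have [W EW detW] := oriented_change L_oriented oJu oE.
exists V, phi, u, W; split=> // z Vz.
by apply/(oriented_det L_oriented W (oJ z Vz)).
Qed.

Section AdaptedFrame.
Variables (V : set 'rV[R]_2) (phi : 'rV[R]_2 -> 'rV[R]_4) (W : 'M[R]_2).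
Hypothesis pphi : local_param L V phi.
Hypothesis frame : forall z, V z -> or (phi z) (W *m jacobian phi z).
Let f i z := 'D_(row i W) phi z.
Let h z := (Num.sqrt (gram2 (f 0 z) (f 1 z)))^-1.

Lemma row_frame i z : V z -> row i (W *m jacobian phi z) = f i z.
Proof.
by move=> Vz; rewrite row_mul /f deriveEjacobian //; exact: local_param_differentiable pphi Vz.
Qed.

Lemma frame_differentiable i z : V z -> differentiable (f i) z.
Proof.
have [_ sphi _ _ _] := pphi.
by apply: smooth_on_differentiable; exact: smooth_on_derive.
Qed.

Lemma jL_frame z : V z -> jL or (phi z) = h z *: wedge (f 0 z) (f 1 z).
Proof.
by move=> Vz; have [_ + _] := oframe_change L_oriented (frame Vz); rewrite !row_frame.
Qed.

Lemma JL_frame z X : V z -> JL or (phi z) X =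
  h z *: (dot X (f 0 z) *: f 1 z - dot X (f 1 z) *: f 0 z).
Proof.
by move=> Vz; have [_ _] := oframe_change L_oriented (frame Vz); rewrite !row_frame.
Qed.

Lemma gram_frame_gt0 z : V z -> 0 < gram2 (f 0 z) (f 1 z).
Proof.
by move=> Vz; have [+ _ _] := oframe_change L_oriented (frame Vz); rewrite !row_frame.
Qed.

Lemma near_param u : V u -> \forall z \near u, V z.
Proof. by move=> Vu; have [oV _ _ _ _] := pphi; exact: open_nbhs_nbhs. Qed.

Lemma normalizer_differentiable u : V u -> differentiable h u.
Proof.
move=> Vu; have d i := frame_differentiable i Vu.
have [|+ _] := @derive_rsqrt _ _ (fun z => gram2 (f 0 z) (f 1 z)) u 0 (gram_frame_gt0 Vu).
  exact: differentiable_gram2.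
exact.
Qed.

(** The normalizing factor equals 1 at [u], and its derivative [c] contributes only a multiple of
    [jL]; as the projection onto V_- kills this term, the value of [c] may stay unspecified. *)
Lemma jL_derive u w : V u -> orthonormal_rows (W *m jacobian phi u) ->
  differentiable (jL or \o phi) u /\ exists c : R,
    'D_w (jL or \o phi) u = c *: jL or (phi u) +
      (wedge ('D_w (f 0) u) (f 1 u) + wedge (f 0 u) ('D_w (f 1) u)).
Proof.
move=> Vu /orthonormal_rows2P; rewrite !row_frame // => -[f00 f11 f01].
have d i := frame_differentiable i Vu.
have dh := normalizer_differentiable Vu.
have near_eq : \forall z \near u, h z *: wedge (f 0 z) (f 1 z) = (jL or \o phi) z.
  by apply: filterS (near_param Vu) => z Vz; rewrite /= jL_frame.
have [dw Dw] := derive_bilinear w (@bilinear_wedge R) (d 0) (d 1).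
have [dhw Dhw] := derive_scale w dh dw.
split; first exact: near_eq_differentiable near_eq dhw.
have hu : h u = 1.
  by rewrite /h (gram2_orthonormal f00 f11 f01) sqrtr1 invr1.
exists ('D_w h u); rewrite -(near_eq_derive _ near_eq) Dhw Dw.
by rewrite jL_frame // hu !scale1r.
Qed.

Lemma JL_differentiable u (X : 'rV[R]_2 -> 'rV[R]_4) : V u ->
  differentiable X u -> differentiable (fun z => JL or (phi z) (X z)) u.
Proof.
move=> Vu dX; have d i := frame_differentiable i Vu.
have near_eq : \forall z \near u,
    h z *: (dot (X z) (f 0 z) *: f 1 z - dot (X z) (f 1 z) *: f 0 z) =
    JL or (phi z) (X z).
  by apply: filterS (near_param Vu) => z Vz; rewrite JL_frame.
apply: near_eq_differentiable near_eq _.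
apply: differentiable_scale; first exact: normalizer_differentiable.
by apply: differentiableB; apply: differentiable_scale => //; exact: differentiable_dot.
Qed.

End AdaptedFrame.

Lemma JL_JL p X : L p -> JL or p (JL or p X) =
  - (dot X (row 0 (oframe or p)) *: row 0 (oframe or p) +
     dot X (row 1 (oframe or p)) *: row 1 (oframe or p)).
Proof.
move=> /(oframeP L_oriented)[_ /orthonormal_rows2P[e1 e2 e12]].
rewrite /JL; move: (row 0 _) (row 1 _) e1 e2 e12 => x y xx yy xy.
rewrite !(dotDl, dotNl, dotZl) xx yy xy (dotC y x) xy.
by move: (dot X x) (dot X y) => a b; row_ring.
Qed.

Lemma tangent_oframe p X : L p -> tangent_space 2 L p X <->
  exists a b : R, X = a *: row 0 (oframe or p) + b *: row 1 (oframe or p).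
Proof.
move=> /(oframeP L_oriented)[oE _]; rewrite (oriented_span L_oriented oE).
exact: row_span2P.
Qed.

(** [JL] kills normal vectors and is the quarter turn on tangent ones, so its square is minus the
    tangential projection and this is the normal projection. Written through [JL], it inherits
    differentiability along L from [JL_differentiable]. *)
Definition normal_part nu p := nu + JL or p (JL or p nu).

Lemma dot_normal_part p X nu : L p -> tangent_space 2 L p X ->
  dot X (normal_part nu p) = 0.
Proof.
move=> Lp /(tangent_oframe _ Lp)[a [b ->]]; rewrite /normal_part JL_JL //.
have [_ /orthonormal_rows2P[]] := oframeP L_oriented Lp.
move: (row 0 _) (row 1 _) => x y xx yy xy.
rewrite !(dotDl, dotDr, dotNl, dotNr, dotZl, dotZr) xx yy xy (dotC y x) xy.
rewrite (dotC nu x) (dotC nu y); ring.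
Qed.

Lemma normal_spaceP p nu : L p -> Defs.normal_space 2 L p nu <->
  dot nu (row 0 (oframe or p)) = 0 /\ dot nu (row 1 (oframe or p)) = 0.
Proof.
move=> Lp; split=> [H|[n0 n1] X /(tangent_oframe _ Lp)[a [b ->]]].
  by split; apply: H; apply/(tangent_oframe _ Lp); [exists 1, 0|exists 0, 1];
    rewrite scale1r scale0r ?addr0 ?add0r.
by rewrite dotDr !dotZr n0 n1 !mulr0 addr0.
Qed.

Lemma normal_part_id p nu : L p -> Defs.normal_space 2 L p nu -> normal_part nu p = nu.
Proof.
move=> Lp /(normal_spaceP _ Lp)[n0 n1].
by rewrite /normal_part JL_JL // n0 n1 !scale0r addr0 oppr0 addr0.
Qed.

Lemma orth_proj_normal p X : L p ->
  orth_proj (Defs.normal_space 2 L p) X = normal_part X p.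
Proof.
move=> Lp; apply: orth_projE => [Y TY|nu Nnu].
  by rewrite dotC; exact: dot_normal_part.
rewrite /normal_part opprD addrA subrr sub0r JL_JL // opprK dotC; apply: Nnu.
by apply/(tangent_oframe _ Lp); do 2 eexists.
Qed.

Lemma normal_part_differentiable (V : set 'rV[R]_2) phi u nu : local_param L V phi -> V u ->
  differentiable (normal_part nu \o phi) u.
Proof.
move=> pphi Vu; have Lp := local_param_in pphi Vu.
have [oE _] := oframeP L_oriented Lp.
(* The given [phi] may reverse the orientation, so differentiability is established in an adapted
   parametrization and transported by the chain rule. *)
have [V' [phi' [u' [W [pphi' V'u' e _ oW]]]]] := adapted_param oE.
have [A /(_ _ (normal_part nu))[|//]] :=
  param_chain_rule pphi Vu pphi' V'u' (esym e).
apply: differentiableD; first exact: differentiable_cst.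
apply: (JL_differentiable pphi' oW V'u').
exact: (JL_differentiable pphi' oW V'u').
Qed.

(* Differentiating [dot ('D_w' phi) (normal_part nu) = 0] along phi expresses
   the normal curvature through the derivative of a map defined on L. *)
Lemma shape_operator (V : set 'rV[R]_2) phi u w w' nu : local_param L V phi -> V u ->
  Defs.normal_space 2 L (phi u) nu ->
  dot ('D_w (fun z => 'D_w' phi z) u) nu =
  - dot ('D_w' phi u) ('D_w (normal_part nu \o phi) u).
Proof.
move=> pphi Vu Nnu; have Lp := local_param_in pphi Vu.
have [_ sphi _ _ _] := pphi.
have d1 : differentiable (fun z => 'D_w' phi z) u.
  by apply: smooth_on_differentiable Vu; exact: smooth_on_derive.
have d2 := normal_part_differentiable nu pphi Vu.
have [_ D] := derive_dot w d1 d2.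
have near0 : \forall z \near u,
    cst 0 z = dot ('D_w' phi z) ((normal_part nu \o phi) z).
  apply: filterS (near_param pphi Vu) => z Vz /=; rewrite dot_normal_part //.
    exact: local_param_in pphi Vz.
  by exists V, phi, z, w'.
move: D; rewrite -(near_eq_derive _ near0) derive_cst /= normal_part_id //.
by move=> /esym/eqP; rewrite addr_eq0 => /eqP.
Qed.

(** By [shape_operator] each side equals minus the pairing of the tangent vector [Y] with a first
    derivative along L. Such derivatives do not depend on the parametrization, so neither does the
    value chosen by [xget], as far as pairings with [nu] can tell. *)
Lemma second_fundamental_formE (V : set 'rV[R]_2) phi u w w' nu : local_param L V phi -> V u ->
  Defs.normal_space 2 L (phi u) nu ->
  dot (second_fundamental_form 2 L (phi u) ('D_w phi u) ('D_w' phi u)) nu =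
  dot ('D_w (fun z => 'D_w' phi z) u) nu.
Proof.
move=> pphi Vu Nnu; have Lp := local_param_in pphi Vu.
have proj X : dot (orth_proj (Defs.normal_space 2 L (phi u)) X) nu = dot X nu.
  rewrite orth_proj_normal // /normal_part JL_JL // dotDl dotNl dotDl !dotZl.
  have /(normal_spaceP _ Lp)[n0 n1] := Nnu.
  by rewrite !(dotC _ nu) n0 n1 !mulr0 addr0 subr0.
rewrite /second_fundamental_form; case: xgetP => [b _|]; last first.
  move=> /(_ (orth_proj (Defs.normal_space 2 L (phi u)) ('D_w (fun z => 'D_w' phi z) u)))[].
  by exists V, phi, u, w, w'.
move=> [V' [phi' [u' [v [v' [[pphi' V'u' e] [eX eY ->]]]]]]].
have Nnu' : Defs.normal_space 2 L (phi' u') nu by rewrite e.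
rewrite proj; apply: etrans (shape_operator v v' pphi' V'u' Nnu') _.
apply: etrans _ (esym (shape_operator w w' pphi Vu Nnu)).
rewrite eY; apply: (congr1 (fun y => - dot ('D_w' phi u) y)).
have d := normal_part_differentiable nu pphi Vu.
by have [] := derive_param_indep pphi' V'u' pphi Vu e d eX.
Qed.

End SecondFundamentalForm.

(** * Minimality and holomorphy at a point *)

Section MinimalityAndHolomorphy.
Context {R : realType}.

Lemma second_derivative_sym m n (V : set 'rV[R]_m) (phi : 'rV[R]_m -> 'rV[R]_n) u v w :
  open V -> smooth_on V phi -> V u ->
  'D_w (fun z => 'D_v phi z) u = 'D_v (fun z => 'D_w phi z) u.
Proof.
move=> oV sphi Vu; have nV : \forall z \near u, V z by exact: open_nbhs_nbhs.
have sD v1 : smooth_on V (fun z => 'D_v1 phi z) by exact: smooth_on_derive.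
have d1 v1 z : V z -> differentiable (fun z => 'D_v1 phi z) z.
  exact: smooth_on_differentiable.
apply/rowP => i; pose phi_i y := phi y 0 i.
have key v1 v2 : ('D_v2 (fun z => 'D_v1 phi z) u) 0 i = 'D_v2 ('D_v1 phi_i) u.
  rewrite (derive_coord v2 i (d1 v1 u Vu)); apply: near_eq_derive.
  apply: filterS nV => z Vz; rewrite (derive_coord v1 i) //.
  exact: smooth_on_differentiable Vz.
have C1 : Ck_scalar 1 V phi_i by exact: smooth_coord.
have C2 : Ck_scalar 2 V phi_i by exact: smooth_coord.
apply: etrans (key v w) (etrans _ (esym (key w v))).
have dphi : forall z, V z -> differentiable phi_i z by have [] := C1.
have dD v1 : forall z, V z -> differentiable ('D_v1 phi_i) z.
  by have [_ /(_ v1)[]] := C2.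
have cD v1 v2 : {for u, continuous ('D_v2 ('D_v1 phi_i))}.
  by have [_ /(_ v1)[_ /(_ v2)]] := C2; exact.
apply: (derive_sym _ _ _ (cD v w) (cD w v)).
- by apply: filterS nV; exact: dphi.
- by apply: filterS nV; exact: dD.
- by apply: filterS nV; exact: dD.
Qed.

Section Algebra.
Implicit Types (x y a b c v : 'rV[R]_4).

Lemma qmul_wedge_left x y a : qmul (- qmul (qconj y) x) (wedge a y) =
  (2 * dot x y) *: qmul (qconj y) a - dot y y *: qmul (qconj x) a +
  dot a y *: - qmul (qconj y) x.
Proof. rewrite /wedge; quat_ring. Qed.

Lemma qmul_wedge_right x y b : qmul (- qmul (qconj y) x) (wedge x b) =
  - dot x x *: qmul (qconj y) b - dot x b *: - qmul (qconj y) x.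
Proof. rewrite /wedge; quat_ring. Qed.

Lemma wedge_swap x c : wedge x c = qmul (qconj x) c - dot x c *: quat1.
Proof. rewrite /wedge; quat_ring. Qed.

Lemma dot_qmul_qconj x y v : dot (- qmul (qconj y) x) (qmul (qconj x) v) =
  dot x x * dot v y - 2 * dot x y * dot x v.
Proof. dot_ring. Qed.

(** Left multiplication by [conj x] is an isometry taking [x] to 1 and [y] to [j = - conj y x]. It
    carries the tangent plane to V_+ and the normal plane to V_-, hence intertwines the two
    projections. *)
Lemma proj_minus_qconj_mul x y v : dot x x = 1 -> dot x y = 0 ->
  proj_minus (- qmul (qconj y) x) (qmul (qconj x) v) =
  qmul (qconj x) (v - (dot v x *: x + dot v y *: y)).
Proof.
move=> xx xy; rewrite /proj_minus dot_qmul_qconj xx xy.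
rewrite !(qmulDr, qmulNr, qmulZr).
have -> : qmul (qconj x) x = dot x x *: quat1 by quat_ring.
have -> : qmul (qconj x) v 0 0 = dot v x by dot_ring.
have -> : qmul (qconj x) y = (2 * dot x y) *: quat1 - qmul (qconj y) x by quat_ring.
rewrite xx xy; move: (qmul (qconj x) v) (qmul (qconj y) x) => p q; row_ring.
Qed.

(* The second derivatives [a], [b], [c] of a parametrization in an orthonormal
   frame [x], [y] enter the failure of [jL] to be (anti)holomorphic only through
   the mean curvature, the normal part of [a + c]. *)
Lemma proj_minus_wedge x y a b c (j : 'rV[R]_4 := - qmul (qconj y) x) :
  dot x x = 1 -> dot y y = 1 -> dot x y = 0 ->
  proj_minus j (wedge b y + wedge x c) -
    qmul j (proj_minus j (wedge a y + wedge x b)) =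
  qmul (qconj x) ((a + c) - (dot (a + c) x *: x + dot (a + c) y *: y)).
Proof.
move=> xx yy xy.
have j0 : j 0 0 = 0.
  have -> : j 0 0 = - dot x y by rewrite /j; dot_ring.
  by rewrite xy oppr0.
have jj : dot j j = 1.
  rewrite /j dotNl dotNr opprK dot_qmul_qmul xx mulr1 -yy; dot_ring.
rewrite -proj_minus_qmul // -proj_minusN -proj_minusD -proj_minus_qconj_mul //.
have El := qmul_wedge_left x y a; have Er := qmul_wedge_right x y b.
rewrite -/j xx yy xy in El Er; rewrite -[X in _ = proj_minus X _]/j.
rewrite (qmulDr j) El Er (wedge_swap x c) {1}/wedge (qmulDr (qconj x)).
move: (qmul (qconj x) a) (qmul (qconj x) c) => xa xc.
move: (qmul (qconj y) a) (qmul (qconj y) b) => ya yb.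
(* The two occurrences of [conj y b] cancel, so the mixed derivative [b] survives only in multiples
   of 1 and [j], which the projection removes. *)
rewrite [X in proj_minus j X](_ : _ = xa + xc +
  ((dot b y - dot x c) *: quat1 + (dot x b - dot a y) *: j)); last first.
  by move: j {j0 jj El Er} => j; row_ring.
by rewrite proj_minusD proj_minus_kill // addr0.
Qed.

End Algebra.

End MinimalityAndHolomorphy.

Section PointwiseConditions.
Context {R : realType}.
Variables (L : set 'rV[R]_4) (or : 'rV[R]_4 -> 'M[R]_(2, 4) -> Prop).
Hypothesis L_oriented : orientation L or.
Implicit Types (p X nu v : 'rV[R]_4) (E : 'M[R]_(2, 4)).

Lemma JL_JL_orthonormal p E v : or p E -> orthonormal_rows E ->
  JL or p (JL or p v) = - (dot v (row 0 E) *: row 0 E + dot v (row 1 E) *: row 1 E).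
Proof.
move=> oE ON; have [_ JE] := oriented_orthonormal L_oriented oE ON.
have /orthonormal_rows2P[] := ON; rewrite !JE.
move: (row 0 E) (row 1 E) => x y xx yy xy.
rewrite !(dotDl, dotNl, dotZl) xx yy xy (dotC y x) xy.
by move: (dot v x) (dot v y) => a b; row_ring.
Qed.

Lemma dot_normal_partl p v nu : L p -> Defs.normal_space 2 L p nu ->
  dot (normal_part or v p) nu = dot v nu.
Proof.
move=> Lp /(normal_spaceP L_oriented _ Lp)[n0 n1].
rewrite /normal_part (JL_JL L_oriented) // dotDl dotNl dotDl !dotZl !(dotC _ nu) n0 n1.
by rewrite !mulr0 addr0 subr0.
Qed.

Lemma normal_part_normal p v : L p -> Defs.normal_space 2 L p (normal_part or v p).
Proof. by move=> Lp X TX; rewrite dotC; exact: (dot_normal_part L_oriented). Qed.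

Lemma qmul_qconj_eq0 (x v : 'rV[R]_4) : dot x x = 1 -> qmul (qconj x) v = 0 -> v = 0.
Proof.
move=> xx xv; have -> : v = dot x x *: v by rewrite xx scale1r.
have -> : dot x x *: v = qmul x (qmul (qconj x) v) by quat_ring.
by rewrite xv; quat_ring.
Qed.

Lemma proj_minus_wedge_add (j x y a b b' c d0 d1 : 'rV[R]_4) (c0 c1 : R) :
  j 0 0 = 0 -> dot j j = 1 -> j = - qmul (qconj y) x ->
  dot x x = 1 -> dot y y = 1 -> dot x y = 0 -> b = b' ->
  d0 = c0 *: j + (wedge a y + wedge x b) ->
  d1 = c1 *: j + (wedge b' y + wedge x c) ->
  proj_minus j d1 - qmul j (proj_minus j d0) =
  qmul (qconj x) ((a + c) - (dot (a + c) x *: x + dot (a + c) y *: y)).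
Proof.
move=> j0 jj jE xx yy xy <- -> ->.
have kill r s : proj_minus j (r *: j + s) = proj_minus j s.
  by rewrite proj_minusD -[r *: j]add0r -(scale0r quat1) proj_minus_kill ?add0r.
by rewrite !kill jE; exact: proj_minus_wedge.
Qed.

Section Frame.
Variables (V : set 'rV[R]_2) (phi : 'rV[R]_2 -> 'rV[R]_4) (u : 'rV[R]_2) (W : 'M[R]_2).
Hypothesis pphi : local_param L V phi.
Hypothesis Vu : V u.
Hypothesis frame : forall z, V z -> or (phi z) (W *m jacobian phi z).
Let p := phi u.
Let E := W *m jacobian phi u.
Hypothesis ON : orthonormal_rows E.
Let j := jL or p.
Let oE : or p E := frame Vu.
Let Lp : L p := local_param_in pphi Vu.

Lemma row_frame_at i : row i E = 'D_(row i W) phi u.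
Proof. exact: (row_frame W pphi i Vu). Qed.

Lemma jL_derive_mean_curvature : proj_minus j ('D_(row 1 W) (jL or \o phi) u) -
    qmul j (proj_minus j ('D_(row 0 W) (jL or \o phi) u)) =
  qmul (qconj (row 0 E)) (normal_part or
    ('D_(row 0 W) (fun z => 'D_(row 0 W) phi z) u +
     'D_(row 1 W) (fun z => 'D_(row 1 W) phi z) u) p).
Proof.
have [_ [c0 D0]] := jL_derive L_oriented pphi frame (row 0 W) Vu ON.
have [_ [c1 D1]] := jL_derive L_oriented pphi frame (row 1 W) Vu ON.
have [oV sphi _ _ _] := pphi.
(* The mixed second derivative appears in the derivatives of [jL] in both directions, in opposite
   orders; the cancellation requires them to be equal. *)
have sym := second_derivative_sym (row 1 W) (row 0 W) oV sphi Vu.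
have [jE _] := oriented_orthonormal L_oriented oE ON.
have jj := dot_jL L_oriented Lp; have j0 := jL00 L_oriented Lp.
rewrite /normal_part (JL_JL_orthonormal _ oE ON).
have /orthonormal_rows2P[] := ON; move: jE; rewrite !row_frame_at => jE xx yy xy.
exact: (proj_minus_wedge_add j0 jj jE xx yy xy sym D0 D1).
Qed.

Lemma mean_curvature_iff :
  (forall nu, Defs.normal_space 2 L p nu ->
    \sum_(i < 2) dot (second_fundamental_form 2 L p (row i E) (row i E)) nu = 0) <->
  proj_minus j ('D_(row 1 W) (jL or \o phi) u) =
  qmul j (proj_minus j ('D_(row 0 W) (jL or \o phi) u)).
Proof.
have H := jL_derive_mean_curvature.
set h := 'D_(row 0 W) _ u + _ in H.
have sumE nu : Defs.normal_space 2 L p nu ->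
    \sum_(i < 2) dot (second_fundamental_form 2 L p (row i E) (row i E)) nu = dot h nu.
  move=> Nnu; rewrite sum_ord2 !row_frame_at.
  have e i := second_fundamental_formE L_oriented (row i W) (row i W) pphi Vu Nnu.
  exact: etrans (congr2 +%R (e 0) (e 1)) (esym (dotDl _ _ _)).
have hN := normal_part_normal h Lp.
split=> [Hnu|e nu Nnu].
  apply/subr0_eq; rewrite H.
  suff -> : normal_part or h p = 0 by quat_ring.
  (* The trace condition is tested on the mean curvature vector itself, which makes its squared
     length zero. *)
  apply: dot_eq0; rewrite (dot_normal_partl _ Lp hN) -(sumE _ hN); exact: Hnu.
rewrite sumE // -(dot_normal_partl h Lp Nnu).
suff -> : normal_part or h p = 0 by rewrite dot0l.
have /orthonormal_rows2P[xx _ _] := ON.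
apply: (qmul_qconj_eq0 xx); apply: etrans (esym H) _.
by apply/eqP; rewrite subr_eq0; apply/eqP; exact: e.
Qed.

(** With P0, P1 the projected derivatives of [psi], [dbar] at the first frame vector is half of
    [P0 + j P1]; multiplying by [j] turns its vanishing into [P1 = j P0]. This relation in turn
    cancels [dbar] on every combination of the frame. *)
Lemma dbar_iff psi : differentiable (psi \o phi) u ->
  (forall X, tangent_space 2 L p X -> dbar L or psi p X = 0) <->
  proj_minus j ('D_(row 1 W) (psi \o phi) u) =
  qmul j (proj_minus j ('D_(row 0 W) (psi \o phi) u)).
Proof.
move=> dpsi; have jj := dot_jL L_oriented Lp; have j0 := jL00 L_oriented Lp.
set D1 := 'D_(row 1 W) _ u; set D0 := 'D_(row 0 W) _ u.
have dphi := local_param_differentiable pphi Vu.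
have lin (m : nat) (f : 'rV[R]_2 -> 'rV[R]_m) (a b : R) : differentiable f u ->
    'D_(a *: row 0 W + b *: row 1 W) f u =
    a *: 'D_(row 0 W) f u + b *: 'D_(row 1 W) f u.
  by move=> df; rewrite !deriveE // linearD !linearZ.
have nabla a b : nablaVminus L or psi p (a *: row 0 E + b *: row 1 E) =
    a *: proj_minus j D0 + b *: proj_minus j D1.
  rewrite /nablaVminus (orth_proj_Vminus L_oriented) // -!proj_minusZ -proj_minusD.
  rewrite !row_frame_at -(lin _ phi) // /p (deriv_alongE _ pphi Vu dpsi).
  by rewrite (lin _ (psi \o phi)).
have Jm v : Vminus or p v -> Jminus or p v = qmul j v by exact: (JminusE L_oriented).
have Vm s : Vminus or p (proj_minus j s).
  apply/VminusP; split; first by rewrite /proj_minus !vE j0; ring.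
  by rewrite /proj_minus !(dotDr, dotNr, dotZr) dot_quat1r jj j0; ring.
have [_ JE] := oriented_orthonormal L_oriented oE ON.
have /orthonormal_rows2P[xx yy xy] := ON.
have JEE a b : JL or p (a *: row 0 E + b *: row 1 E) = (- b) *: row 0 E + a *: row 1 E.
  rewrite JE !(dotDl, dotZl) xx yy xy (dotC (row 1 E)) xy.
  by rewrite !mulr1 !mulr0 addr0 add0r scaleNr addrC.
have dbarE a b : dbar L or psi p (a *: row 0 E + b *: row 1 E) =
    2^-1 *: ((a *: proj_minus j D0 + b *: proj_minus j D1) +
      qmul j ((- b) *: proj_minus j D0 + a *: proj_minus j D1)).
  rewrite /dbar JEE !nabla Jm // -!proj_minusZ -proj_minusD; exact: Vm.
move: (proj_minus j D0) (proj_minus j D1) dbarE {nabla} => P0 P1 dbarE.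
split=> [H|e X].
  have : dbar L or psi p (1 *: row 0 E + 0 *: row 1 E) = 0.
    by apply: H; rewrite (oriented_span L_oriented oE); apply/row_span2P; do 2 eexists.
  rewrite dbarE oppr0 !scale1r !scale0r addr0 add0r => /eqP.
  rewrite scaler_eq0 invr_eq0 pnatr_eq0 /= => /eqP s0.
  have : qmul j (P0 + qmul j P1) = 0.
    by rewrite s0; quat_ring.
  rewrite qmulDr qmul_unit_imag // => /subr0_eq; exact: esym.
rewrite (oriented_span L_oriented oE) => /row_span2P[a [b ->]].
rewrite dbarE e qmulDr !qmulZr qmul_unit_imag //.
move: (qmul j _) => q.
have -> : a *: P0 + b *: q + (- b *: q + a *: - P0) = 0.
  by rewrite scaleNr scalerN [X in _ + X]addrC -opprD subrr.
by rewrite scaler0.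
Qed.

End Frame.

(** An orthonormal basis of the tangent plane has either orientation, and exchanging its two vectors
    reverses the orientation without changing the trace. *)
Lemma minimalP : minimal 2 L <->
  forall p E, or p E -> orthonormal_rows E ->
  forall nu, Defs.normal_space 2 L p nu ->
    \sum_(i < 2) dot (second_fundamental_form 2 L p (row i E) (row i E)) nu = 0.
Proof.
split=> [H p E oE ON nu Nnu|H p E nu Lp [ON TE] Nnu].
  apply: H => //; first exact: (oriented_in L_oriented oE).
  by split=> //; exact: (oriented_span L_oriented oE).
have [oF ONF] := oframeP L_oriented Lp; set F := oframe or p in oF ONF.
have /submxP[A EF] : (E <= F)%MS.
  apply/row_subP => i; have : row_span E (row i E) by exact: row_span_row.
  by rewrite -TE (oriented_span L_oriented oF).
have detA : \det A ^+ 2 = 1.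
  move: ON ONF => /orthonormal_rows2P[] + + + /orthonormal_rows2P[].
  rewrite EF !row_mulmx2 det_mx2; move: (row 0 F) (row 1 F) => x y.
  move: (A 0 0) (A 0 1) (A 1 0) (A 1 1) => a b c d.
  rewrite !(dotDl, dotDr, dotZl, dotZr) => + + + xx yy xy.
  rewrite (dotC y x) xx yy xy => h1 h2 h3.
  have e1 : a ^+ 2 + b ^+ 2 = 1 by rewrite -h1; ring.
  have e2 : c ^+ 2 + d ^+ 2 = 1 by rewrite -h2; ring.
  have e3 : a * c + b * d = 0 by rewrite -h3; ring.
  (* Lagrange's identity: orthonormality of both frames gives [\det A ^+ 2 = 1], which excludes a
     zero determinant below. *)
  have -> : (a * d - b * c) ^+ 2 =
      (a ^+ 2 + b ^+ 2) * (c ^+ 2 + d ^+ 2) - (a * c + b * d) ^+ 2 by ring.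
  by rewrite e1 e2 e3; ring.
have [A0|A0|A0] := ltgtP 0 (\det A); last first.
- by move: detA; rewrite -A0 expr0n => /eqP; rewrite eq_sym oner_eq0.
- pose S : 'M[R]_2 := \matrix_(i, k) (i != k)%:R.
  have oSE : or p (S *m E).
    rewrite EF mulmxA; apply/(oriented_det L_oriented _ oF).
    by rewrite det_mulmx det_mx2 !mxE /= mulr0 sub0r mulr1 mulN1r oppr_gt0.
  have r0 : row 0 (S *m E) = row 1 E.
    by rewrite row_mulmx2 !mxE /= scale0r scale1r add0r.
  have r1 : row 1 (S *m E) = row 0 E.
    by rewrite row_mulmx2 !mxE /= scale0r scale1r addr0.
  have ONS : orthonormal_rows (S *m E).
    by apply/orthonormal_rows2P; rewrite r0 r1 dotC; move/orthonormal_rows2P: ON => [].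
  by have := H p _ oSE ONS nu Nnu; rewrite !sum_ord2 r0 r1 addrC.
- by apply: H => //; rewrite EF; apply/(oriented_det L_oriented _ oF).
Qed.

End PointwiseConditions.

(** * The total space of the affine bundle X_psi *)

(** For orthonormal [x], [y] and [j = - conj y x] this says [x j = y]: octonion multiplication by
    [j] turns the first frame vector into the second. *)
Lemma qmul_qconj_sandwich {R : realType} (x y : 'rV[R]_4) :
  qmul x (- qmul (qconj y) x) = dot x x *: y - (2 * dot x y) *: x.
Proof. quat_ring. Qed.

Lemma cayley_span_iff {R : realType} (T : set 'rV[R]_(4 + 4)) (j x y a0 a1 : 'rV[R]_4) :
  j 0 0 = 0 -> dot j j = 1 -> dot x x = 1 -> dot y y = 1 -> dot x y = 0 ->
  qmul x j = y ->
  (forall X, T X <-> exists c d r t : R,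
    X = oct (c *: quat1 + d *: j + (r *: a0 + t *: a1)) (r *: x + t *: y)) ->
  cayley_subspace T <-> proj_minus j a1 = qmul j (proj_minus j a0).
Proof.
move=> j0 jj xx yy xy xj TP.
have x0 : x != 0 by apply: contra_eq_neq xx => ->; rewrite dot0l eq_sym oner_eq0.
have T1 : T (oct quat1 0).
  by apply/TP; exists 1, 0, 0, 0; rewrite !scale0r !scale1r !addr0.
have Tj : T (oct j 0).
  by apply/TP; exists 0, 1, 0, 0; rewrite !scale0r !scale1r !addr0 add0r.
have T0 : T (oct a0 x).
  by apply/TP; exists 0, 0, 1, 0; rewrite !scale0r !scale1r !addr0 add0r.
split=> [cay|e].
  have /TP[c [d [r [t]]]] := cayley_subspace_mul cay T1 Tj T0.
  rewrite omul_oct => /oct_inj[e1 e2].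
  have {}e1 : qmul j a0 = c *: quat1 + d *: j + (r *: a0 + t *: a1).
    by rewrite -e1; quat_ring.
  have {}e2 : y = r *: x + t *: y by rewrite -e2 -xj; quat_ring.
  (* The component in He is [x j = y], and comparing it with [r x + t y] fixes [r = 0] and [t = 1];
     so [j a0] and [a1] differ by a combination of 1 and [j]. *)
  have r0 : r = 0.
    by have := congr1 (dot x) e2; rewrite dotDr !dotZr xx xy mulr0 mulr1 addr0.
  have t1 : t = 1.
    by have := congr1 (dot y) e2; rewrite dotDr !dotZr yy r0 mul0r add0r mulr1.
  rewrite -proj_minus_qmul // e1 r0 t1 scale0r scale1r add0r proj_minusD.
  by rewrite proj_minus_kill // add0r.
pose v : 'rV[R]_4 := proj_minus j a0; rewrite -/v in e.
(* Replacing [a0], [a1] by their projections alters the spanning vectors only by multiples of 1 and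
   [j], which belong to [T]. *)
have comb (r t : R) : r *: a0 + t *: a1 = r *: v + t *: qmul j v +
    ((r * a0 0 0 + t * a1 0 0) *: quat1 + (r * dot j a0 + t * dot j a1) *: j).
  by rewrite -e /v /proj_minus; row_ring.
have v0 : v 0 0 = 0 by rewrite /v /proj_minus !vE j0; ring.
have jv : dot j v = 0.
  by rewrite /v /proj_minus !(dotDr, dotNr, dotZr) dot_quat1r jj j0; ring.
have := cayley_complex_span j0 jj v0 jv x0.
set B := \matrix_(i < 4) _; suff -> : T = row_span B by [].
have B0 : row 0 B = oct quat1 0 by rewrite rowK.
have B1 : row 1 B = oct j 0 by rewrite rowK.
have B2 : row 2 B = oct v x by rewrite rowK.
have B3 : row 3 B = oct (qmul j v) y by rewrite rowK -xj.
apply/seteqP; split=> X.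
  move=> /TP[c [d [r [t ->]]]]; apply/row_span4P; rewrite B0 B1 B2 B3.
  exists (c + r * a0 0 0 + t * a1 0 0), (d + r * dot j a0 + t * dot j a1), r, t.
  rewrite !octE !scaler0 !add0r; congr oct.
  by rewrite comb; row_ring.
move=> /row_span4P[c [d [r [t ->]]]]; rewrite B0 B1 B2 B3; apply/TP.
exists (c - r * a0 0 0 - t * a1 0 0), (d - r * dot j a0 - t * dot j a1), r, t.
rewrite !octE !scaler0 !add0r; congr oct.
by rewrite comb; row_ring.
Qed.

(** * Local parametrizations of X_psi and its tangent spaces *)

Section LiftedParametrization.
Context {R : realType}.

Lemma Ck_scalar_coord m k (U : set 'rV[R]_m) i : Ck_scalar k U (fun w => w 0 i).
Proof.
case: k => [|k] /=; first by move=> x _; exact: coord_continuous.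
split=> [x _|v]; first exact: differentiable_coord.
under eq_fun => x.
  rewrite -(derive_coord v i (is_diff_id x).(ex_diff)) derive_id; over.
exact: Ck_scalar_cst.
Qed.

Lemma derive_oct (V : normedModType R) (f g : V -> 'rV[R]_4) x v :
  differentiable f x -> differentiable g x ->
  differentiable (fun z => oct (f z) (g z)) x /\
  'D_v (fun z => oct (f z) (g z)) x = oct ('D_v f x) ('D_v g x).
Proof.
move=> df dg.
have dl i : (fun z => oct (f z) (g z) 0 (lshift 4 i)) = (fun z => f z 0 i).
  by apply/funext => z; rewrite /oct row_mxEl.
have dr i : (fun z => oct (f z) (g z) 0 (rshift 4 i)) = (fun z => g z 0 i).
  by apply/funext => z; rewrite /oct row_mxEr.
have d : differentiable (fun z => oct (f z) (g z)) x.
  apply/differentiable_rowP => i; rewrite -[i]splitK; case: (fintype.split i) => k /=.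
    by rewrite dl; move: k; apply/differentiable_rowP.
  by rewrite dr; move: k; apply/differentiable_rowP.
split=> //; apply/rowP => i; rewrite derive_coord //.
rewrite -[i]splitK; case: (fintype.split i) => k /=.
  by rewrite dl /oct row_mxEl derive_coord.
by rewrite dr /oct row_mxEr derive_coord.
Qed.

Lemma derive_linear_comp m n (W : normedModType R) (l : {linear 'rV[R]_m -> 'rV[R]_n})
    (f : 'rV[R]_n -> W) x v : differentiable f (l x) ->
  differentiable (fun z => f (l z)) x /\ 'D_v (fun z => f (l z)) x = 'D_(l v) f (l x).
Proof.
move=> df; have cl := @linear_row_continuous R m _ l.
have dl := @linear_differentiable _ _ _ l x cl.
have dc : differentiable (fun z => f (l z)) x by exact: differentiable_comp dl df.
split=> //; rewrite (deriveE _ dc) (deriveE _ df).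
by apply: etrans (congr1 (@^~ v) (diff_comp dl df)) _; rewrite /= diff_lin.
Qed.

Variables (L : set 'rV[R]_4) (or : 'rV[R]_4 -> 'M[R]_(2, 4) -> Prop).
Hypothesis L_oriented : orientation L or.
Variable psi : 'rV[R]_4 -> 'rV[R]_4.
Hypothesis psi_section : smooth_section_Vminus L or psi.
Variables (V : set 'rV[R]_2) (phi : 'rV[R]_2 -> 'rV[R]_4) (W : 'M[R]_2).
Hypothesis pphi : local_param L V phi.
Hypothesis frame : forall z, V z -> or (phi z) (W *m jacobian phi z).

Definition lift_param (w : 'rV[R]_(2 + 2)) : 'rV[R]_(4 + 4) :=
  let z := lsubmx w in
  oct (rsubmx w 0 0 *: quat1 + rsubmx w 0 1 *: jL or (phi z) + psi (phi z)) (phi z).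

Definition lift_domain : set 'rV[R]_(2 + 2) := [set w | V (lsubmx w)].

Let oV : open V. Proof. by have [] := pphi. Qed.

Lemma open_lift_domain : open lift_domain.
Proof.
by apply: (open_comp (f := lsubmx)) => // w _; exact: continuous_lsubmx.
Qed.

Lemma smooth_jL : smooth_on V (jL or \o phi).
Proof.
have [_ sphi _ _ _] := pphi.
have sf i := smooth_on_derive (row i W) sphi.
have G0 := gram_frame_gt0 L_oriented pphi frame.
move=> k; apply/Ck_coordP => // i.
have kw : Ck_scalar k V (fun z => wedge ('D_(row 0 W) phi z) ('D_(row 1 W) phi z) 0 i).
  apply: (Ck_scalar_bilinear (b := fun x y => wedge x y 0 i)) => //; last 2 first.
  - exact: sf.
  - exact: sf.
  by have [bl br] := @bilinear_wedge R; split=> *; rewrite ?bl ?br !mxE.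
have kh := Ck_scalar_rsqrt oV G0 (Ck_scalar_gram2 oV (sf 0 k) (sf 1 k)).
have := Ck_scalarM oV kh kw; apply: Ck_scalar_congr => // z Vz.
by rewrite /= (jL_frame L_oriented pphi frame Vz) [RHS]mxE.
Qed.

Lemma smooth_lift_param : smooth_on lift_domain lift_param.
Proof.
have oD := open_lift_domain; have [_ sphi _ _ _] := pphi.
have spsi : smooth_on V (psi \o phi) by have [+ _] := psi_section; exact.
have comp (n : nat) (f : 'rV[R]_2 -> 'rV[R]_n) k i : smooth_on V f ->
    Ck_scalar k lift_domain (fun w => f (lsubmx w) 0 i).
  move=> sf; apply: (@Ck_scalar_lin R 2 (2 + 2)%N k lsubmx V lift_domain (fun z => f z 0 i)) => //.
  exact: smooth_coord.
have kr k i : Ck_scalar k lift_domain (fun w : 'rV[R]_(2 + 2) => rsubmx w 0 i).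
  by under eq_fun do rewrite mxE; exact: Ck_scalar_coord.
move=> k; apply/Ck_coordP => // i; rewrite -[i]splitK; case: (fintype.split i) => l /=.
  have := Ck_scalarD oD (Ck_scalarD oD
    (Ck_scalarM oD (kr k 0) (Ck_scalar_cst k lift_domain (quat1 0 l)))
    (Ck_scalarM oD (kr k 1) (comp _ _ k l smooth_jL))) (comp _ _ k l spsi).
  apply: Ck_scalar_congr => // w _.
  by rewrite /lift_param /oct row_mxEl !addvE !scalevE.
have := comp _ _ k l sphi; apply: Ck_scalar_congr => // w _.
by rewrite /lift_param /oct row_mxEr.
Qed.

Lemma lift_param_derive w v : lift_domain w ->
  'D_v lift_param w = oct (rsubmx v 0 0 *: quat1 + rsubmx v 0 1 *: jL or (phi (lsubmx w)) +
     (rsubmx w 0 1 *: 'D_(lsubmx v) (jL or \o phi) (lsubmx w) +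
      'D_(lsubmx v) (psi \o phi) (lsubmx w))) ('D_(lsubmx v) phi (lsubmx w)).
Proof.
move=> Vz; have [_ sphi _ _ _] := pphi.
have spsi : smooth_on V (psi \o phi) by have [+ _] := psi_section; exact.
have [dj Dj] := derive_linear_comp (l := lsubmx) v
  (smooth_on_differentiable smooth_jL Vz).
have [dp Dp] := derive_linear_comp (l := lsubmx) v (smooth_on_differentiable spsi Vz).
have [df Df] := derive_linear_comp (l := lsubmx) v (smooth_on_differentiable sphi Vz).
have r_diff i : differentiable (fun w : 'rV[R]_(2 + 2) => rsubmx w 0 i) w.
  by under eq_fun do rewrite mxE; exact: differentiable_coord.
have r_derive i : 'D_v (fun w : 'rV[R]_(2 + 2) => rsubmx w 0 i) w = rsubmx v 0 i.
  under eq_fun do rewrite mxE.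
  by rewrite -(derive_coord v _ (is_diff_id w).(ex_diff)) derive_id mxE.
have [d0 D0] := derive_scale v (r_diff 0) (differentiable_cst (quat1 : 'rV[R]_4) w).
have [d1 D1] := derive_scale v (r_diff 1) dj.
have d01 := differentiableD d0 d1; have d012 := differentiableD d01 dp.
have [_ ->] := derive_oct v d012 df.
rewrite Df; congr oct.
rewrite (deriveD (diff_derivable d01) (diff_derivable dp)).
rewrite (deriveD (diff_derivable d0) (diff_derivable d1)) D0 D1 Dj Dp !r_derive.
by rewrite derive_cst scaler0 addr0 !addrA.
Qed.

Lemma quat1_jL_free p (a b a' b' : R) : L p ->
  a *: quat1 + b *: jL or p = a' *: quat1 + b' *: jL or p -> a = a' /\ b = b'.
Proof.
move=> Lp; have j0 := jL00 L_oriented Lp; have jj := dot_jL L_oriented Lp.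
move=> e; split.
  by have := congr1 (fun s : 'rV[R]_4 => s 0 0) e; rewrite /= !vE j0 !mulr1 !mulr0 !addr0.
have := congr1 (dot (jL or p)) e.
by rewrite !dotDr !dotZr dot_quat1r j0 jj !mulr0 !mulr1 !add0r.
Qed.

Lemma lift_row_free w : lift_domain w -> row_free (jacobian lift_param w).
Proof.
move=> Vw; have [_ _ free _ _] := pphi.
have Vz : V (lsubmx w) by [].
have Lp := local_param_in pphi Vz.
have dL := smooth_on_differentiable smooth_lift_param Vw.
rewrite -kermx_eq0; apply/rowV0P => v /sub_kermxP v0.
have : 'D_v lift_param w = 0 by rewrite deriveEjacobian.
rewrite lift_param_derive // -(row_mx0 R 1 4 4) => /oct_inj[e1 e2].
have dphi := local_param_differentiable pphi Vz.
have l0 : lsubmx v = 0.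
  by apply: (row_free_inj (free _ Vz)); rewrite mul0mx -deriveEjacobian.
rewrite l0 !derive0 scaler0 !addr0 in e1.
have [r0 r1] : rsubmx v 0 0 = 0 /\ rsubmx v 0 1 = 0.
  by apply: (quat1_jL_free Lp); rewrite e1 !scale0r addr0.
rewrite -[v]hsubmxK l0 (_ : rsubmx v = 0) ?row_mx0 //.
by apply/rowP => i; rewrite [RHS]mxE; move: i; apply: all_ord2.
Qed.

Lemma lift_injective w w' : lift_domain w -> lift_domain w' ->
  lift_param w = lift_param w' -> w = w'.
Proof.
move=> Vw Vw' /oct_inj[e1 e2]; have [_ _ _ inj _] := pphi.
have Vz : V (lsubmx w) by [].
have l : lsubmx w = lsubmx w' by exact: inj.
move: e1; rewrite -l => /addIr /(quat1_jL_free (local_param_in pphi Vz))[r0 r1].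
rewrite -[w]hsubmxK -[w']hsubmxK l; congr row_mx.
by apply/rowP; apply: all_ord2.
Qed.

Lemma lift_param_in w : lift_domain w -> Xpsi L or psi (lift_param w).
Proof.
move=> Vw; exists (phi (lsubmx w)); eexists; split; first exact: local_param_in pphi Vw.
  by exists (rsubmx w 0 0), (rsubmx w 0 1).
by [].
Qed.

(* A point (x, s) of X_psi over L has fibre coordinates s_0 and <s, j_L>, which
   depend continuously on it. *)
Lemma lift_open_at (O : set 'rV[R]_(2 + 2)) w : open O -> O `<=` lift_domain -> O w ->
  \forall y \near lift_param w, Xpsi L or psi y -> (lift_param @` O) y.
Proof.
move=> oO OV Ow; have Vw := OV w Ow; have Vz : V (lsubmx w) by [].
set z := lsubmx w in Vz; set a := rsubmx w 0 0; set b := rsubmx w 0 1.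
have Lp := local_param_in pphi Vz.
have Vpsi q : L q -> Vminus or q (psi q) by have [_] := psi_section; exact.
have /nbhs_ballP[e /= e0 He] : nbhs w O by exact: open_nbhs_nbhs.
have cj : {for z, continuous (jL or \o phi)}.
  exact: differentiable_continuous (smooth_on_differentiable smooth_jL Vz).
pose s := lsubmx (lift_param w).
have sE : s = a *: quat1 + b *: jL or (phi z) + psi (phi z).
  by rewrite /s /lift_param /oct row_mxKl.
have coords q (a' b' : R) : L q ->
    (a' *: quat1 + b' *: jL or q + psi q) 0 0 = a' /\
    dot (a' *: quat1 + b' *: jL or q + psi q) (jL or q) = b'.
  move=> Lq; have j0 := jL00 L_oriented Lq; have jj := dot_jL L_oriented Lq.
  have /VminusP[p0 jp] := Vpsi q Lq.
  rewrite !(dotDl, dotZl) dot_quat1 jj (dotC (psi q)) jp !vE p0 j0; split; ring.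
(* The coordinate along [jL] as a function of the spinor and the base parameter jointly, since both
   vary when the point of X_psi moves. *)
pose g (x : 'rV[R]_4 * 'rV[R]_2) := dot x.1 ((jL or \o phi) x.2).
have cg : {for (s, z), continuous g}.
  have c1 i : {for (s, z), continuous (fun x : 'rV[R]_4 * 'rV[R]_2 => x.1 0 i)}.
    apply: (@continuous_comp _ _ _ fst (fun y : 'rV[R]_4 => y 0 i)); first exact: cvg_fst.
    exact: coord_continuous.
  have c2 i : {for (s, z), continuous
      (fun x : 'rV[R]_4 * 'rV[R]_2 => (jL or \o phi) x.2 0 i)}.
    apply: (@continuous_comp _ _ _ (fun x : 'rV[R]_4 * 'rV[R]_2 => (jL or \o phi) x.2)
      (fun y : 'rV[R]_4 => y 0 i)); last exact: coord_continuous.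
    by apply: (@continuous_comp _ _ _ snd (jL or \o phi)); first exact: cvg_snd.
  have -> : g = (fun x => x.1 0 0 * (jL or \o phi) x.2 0 0 +
    x.1 0 1 * (jL or \o phi) x.2 0 1 + x.1 0 2 * (jL or \o phi) x.2 0 2 +
    x.1 0 3 * (jL or \o phi) x.2 0 3) by apply/funext => x; rewrite /g dot4E.
  by apply: continuousD; [apply: continuousD; [apply: continuousD|]|];
    apply: continuousM.
have gb : g (s, z) = b by rewrite /g sE; exact: (coords _ a b Lp).2.
have : \forall x \near (s, z), `|b - g x| < e.
  by rewrite -gb; move/cvgrPdist_lt: cg => /(_ e e0).
move=> [[A B] /= [nA nB] AB].
(* Openness of [phi] onto L turns closeness of base points in R^4 into closeness of their parameters
   to [z]. *)
have [_ _ _ _ /(_ ((B `&` ball z e)^° `&` V))[]] := pphi.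
- by apply: openI => //; exact: open_interior.
- by move=> x [].
move=> U oU UE.
have Uz : U (phi z).
  suff [] : (L `&` U) (phi z) by [].
  rewrite -UE; exists z => //; split=> //.
  by apply: filterI => //; exact: nbhsx_ballx.
have rE : rsubmx (lift_param w) = phi z by rewrite /lift_param /oct row_mxKr.
have n1 : \forall y \near lift_param w, A (lsubmx y) by exact: continuous_lsubmx.
have n2 : \forall y \near lift_param w, U (rsubmx y).
  by apply: continuous_rsubmx; rewrite rE; exact: open_nbhs_nbhs.
have n3 : \forall y \near lift_param w, `|a - (lsubmx y) 0 0| < e.
  have c : {for lift_param w, continuous (fun y : 'rV[R]_(4 + 4) => lsubmx y 0 0)}.
    apply: (@continuous_comp _ _ _ lsubmx (fun y : 'rV[R]_4 => y 0 0)).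
      exact: continuous_lsubmx.
    exact: coord_continuous.
  move/cvgrPdist_lt: c => /(_ e e0); rewrite -/s sE.
  by have [-> _] := coords _ a b Lp.
near=> y => -[q [chi [Lq [a' [b' ->]] yE]]].
have yA : A (lsubmx y) by near: y.
have yU : U (rsubmx y) by near: y.
have ya : `|a - (lsubmx y) 0 0| < e by near: y.
have yl : lsubmx y = a' *: quat1 + b' *: jL or q + psi q by rewrite yE /oct row_mxKl.
have yr : rsubmx y = q by rewrite yE /oct row_mxKr.
rewrite yr in yU.
have : (L `&` U) q by split.
rewrite -UE => -[z' [/interior_subset[Bz' bz'] Vz'] qE].
have [ca cb] := coords q a' b' Lq.
have yb : `|b - b'| < e.
  by have := AB (lsubmx y, z') (conj yA Bz'); rewrite /g /= qE yl cb.
rewrite yl ca in ya.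
exists (row_mx z' (\row_i (if i == 0 then a' else b'))); last first.
  by rewrite /lift_param row_mxKl row_mxKr !mxE /= qE yE.
apply: He; split=> // i k; rewrite [i]ord1 -[k]splitK.
case: (fintype.split k) => l /=.
  rewrite row_mxEl; have [_ /(_ 0 l)] := bz'.
  by rewrite mxE.
rewrite row_mxEr mxE; move: l; apply: all_ord2 => /=.
  by move: ya; rewrite /a mxE.
by move: yb; rewrite /b mxE.
Unshelve. all: by end_near. Qed.

Lemma lift_local_param : local_param (Xpsi L or psi) lift_domain lift_param.
Proof.
split; [exact: open_lift_domain|exact: smooth_lift_param|exact: lift_row_free|
  exact: lift_injective|].
(* The largest open set meeting X_psi only inside the image; [lift_open_at] states that it contains
   the whole image. *)
move=> O oO OV; exists [set y | Xpsi L or psi y -> (lift_param @` O) y]^°.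
  exact: open_interior.
apply/seteqP; split=> [y [w Ow <-]|y [Xy /interior_subset]]; last exact.
split; first by apply: lift_param_in; exact: OV.
exact: lift_open_at.
Qed.

Variable u : 'rV[R]_2.
Hypothesis Vu : V u.
Hypothesis ON : orthonormal_rows (W *m jacobian phi u).
Let p := phi u.
Let E := W *m jacobian phi u.
Let j := jL or p.
Let x := row 0 E.
Let y := row 1 E.
Let oE : or p E := frame Vu.
Let Lp : L p := local_param_in pphi Vu.
Let base (a b : R) : 'rV[R]_(2 + 2) := row_mx u (\row_i (if i == 0 then a else b)).
Let W0 := row 0 W.
Let W1 := row 1 W.
Let s0 (b : R) := b *: 'D_W0 (jL or \o phi) u + 'D_W0 (psi \o phi) u.
Let s1 (b : R) := b *: 'D_W1 (jL or \o phi) u + 'D_W1 (psi \o phi) u.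

Lemma base_domain a b : lift_domain (base a b).
Proof. by rewrite /lift_domain /= row_mxKl. Qed.

Lemma lift_tangentP a b (X : 'rV[R]_(4 + 4)) :
  tangent_space 4 (Xpsi L or psi) (lift_param (base a b)) X <->
  exists c d r t : R,
    X = oct (c *: quat1 + d *: j + (r *: s0 b + t *: s1 b)) (r *: x + t *: y).
Proof.
have Vb := base_domain a b; have pl := lift_local_param.
have dl := local_param_differentiable pl Vb.
have dphi := local_param_differentiable pphi Vu.
have spsi : smooth_on V (psi \o phi) by have [+ _] := psi_section; exact.
have dpsi := smooth_on_differentiable spsi Vu.
have dj := smooth_on_differentiable smooth_jL Vu.
have lin (m : nat) (f : 'rV[R]_2 -> 'rV[R]_m) (r t : R) : differentiable f u ->
    'D_(r *: W0 + t *: W1) f u = r *: 'D_W0 f u + t *: 'D_W1 f u.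
  by move=> df; rewrite !deriveE // linearD !linearZ.
have comb (r t : R) (q0 q1 p0 p1 : 'rV[R]_4) :
    b *: (r *: q0 + t *: q1) + (r *: p0 + t *: p1) =
    r *: (b *: q0 + p0) + t *: (b *: q1 + p1) by row_ring.
have xE : x = 'D_W0 phi u by rewrite /x /E (row_frame W pphi 0 Vu).
have yE : y = 'D_W1 phi u by rewrite /y /E (row_frame W pphi 1 Vu).
have DE (c d r t : R) :
    'D_(row_mx (r *: W0 + t *: W1) (\row_i (if i == 0 then c else d))) lift_param (base a b) =
    oct (c *: quat1 + d *: j + (r *: s0 b + t *: s1 b)) (r *: x + t *: y).
  rewrite lift_param_derive // !row_mxKl !row_mxKr (lin _ phi) // (lin _ (psi \o phi)) //.
  rewrite (lin _ (jL or \o phi)) // -xE -yE !mxE /=; congr oct; congr (_ + _).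
  exact: comb.
rewrite (tangent_spaceE pl Vb); split=> [/submxP[v ->]|[c [d [r [t ->]]]]]; last first.
  by rewrite -DE deriveEjacobian // /row_span /= submxMl.
have [_ _ free _ _] := pphi.
(* The image of the base direction is tangent to L, hence a combination of the frame; injectivity of
   the Jacobian then expresses the direction itself through the rows of [W]. *)
have /row_span2P[r [t vE]] : row_span E (lsubmx v *m jacobian phi u).
  by rewrite -(oriented_span L_oriented oE) (tangent_spaceE pphi Vu); exact: submxMl.
have lE : lsubmx v = r *: W0 + t *: W1.
  apply: (row_free_inj (free _ Vu)).
  by rewrite vE mulmxDl -!scalemxAl /E !row_mul.
exists (rsubmx v 0 0), (rsubmx v 0 1), r, t.
apply: etrans (esym (deriveEjacobian v dl)) (etrans _ (DE _ _ r t)).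
congr ('D_ _ _ _); rewrite -[LHS]hsubmxK lE; congr row_mx.
by apply/rowP; apply: all_ord2; rewrite [RHS]mxE.
Qed.

Lemma lift_cayley_iff a b :
  cayley_subspace (tangent_space 4 (Xpsi L or psi) (lift_param (base a b))) <->
  proj_minus j (s1 b) = qmul j (proj_minus j (s0 b)).
Proof.
have jj : dot j j = 1 := dot_jL L_oriented Lp.
have j0 : j 0 0 = 0 := jL00 L_oriented Lp.
have [jE _] := oriented_orthonormal L_oriented oE ON.
have /orthonormal_rows2P[] := ON; rewrite -/E -/x -/y => xx yy xy.
have xj : qmul x j = y.
  rewrite /j jE -/x -/y.
  by rewrite qmul_qconj_sandwich xx xy mulr0 scale0r subr0 scale1r.
exact: cayley_span_iff j0 jj xx yy xy xj (lift_tangentP a b).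
Qed.

End LiftedParametrization.

(** Over a fixed point of L the fibre of X_psi supplies every value of b, so the affine condition
    splits already there and the equivalence is pointwise on L. *)
Lemma cayley_minimal_holomorphic_at (R : realType) (L : set 'rV[R]_4)
    (or : 'rV[R]_4 -> 'M[R]_(2, 4) -> Prop) (psi : 'rV[R]_4 -> 'rV[R]_4)
    (L_oriented : orientation L or) (psi_section : smooth_section_Vminus L or psi)
    (V : set 'rV[R]_2) (phi : 'rV[R]_2 -> 'rV[R]_4) (W : 'M[R]_2) (u : 'rV[R]_2) :
  local_param L V phi -> (forall z, V z -> or (phi z) (W *m jacobian phi z)) ->
  V u -> orthonormal_rows (W *m jacobian phi u) ->
  (forall z, Xpsi L or psi z -> rsubmx z = phi u ->
     cayley_subspace (tangent_space 4 (Xpsi L or psi) z)) <->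
  (forall nu, Defs.normal_space 2 L (phi u) nu ->
    \sum_(i < 2) dot (second_fundamental_form 2 L (phi u)
      (row i (W *m jacobian phi u)) (row i (W *m jacobian phi u))) nu = 0) /\
  (forall X, tangent_space 2 L (phi u) X -> dbar L or psi (phi u) X = 0).
Proof.
move=> pphi frame Vu ON; have Lp := local_param_in pphi Vu.
have dpsi : differentiable (psi \o phi) u.
  by have [+ _] := psi_section; move=> /(_ V phi pphi)/smooth_on_differentiable; exact.
have Hmin := mean_curvature_iff L_oriented pphi Vu frame ON.
have Hhol := dbar_iff L_oriented pphi Vu frame ON dpsi.
have Hcay := lift_cayley_iff L_oriented psi_section pphi frame Vu ON.
have split_cond (j m0 m1 p0 p1 : 'rV[R]_4) :
    (forall b : R, proj_minus j (b *: m1 + p1) = qmul j (proj_minus j (b *: m0 + p0))) <->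
    proj_minus j m1 = qmul j (proj_minus j m0) /\
    proj_minus j p1 = qmul j (proj_minus j p0).
  split=> [H|[Hm Hp] b]; last first.
    by rewrite !proj_minusD !proj_minusZ qmulDr qmulZr Hm Hp.
  (* The values b = 0 and b = 1 separate the constant term from the linear one. *)
  have Hp : proj_minus j p1 = qmul j (proj_minus j p0).
    by have := H 0; rewrite !scale0r !add0r.
  split=> //; have := H 1; rewrite !scale1r !proj_minusD qmulDr Hp; exact: addIr.
have and_iff (A B C D : Prop) : (A <-> B) -> (C <-> D) -> (A /\ C <-> B /\ D) by tauto.
apply: iff_trans _ (and_iff _ _ _ _ (iff_sym Hmin) (iff_sym Hhol)).
apply: iff_trans _ (split_cond _ _ _ _ _).
split=> [H b|H z [p [chi [_ [a [b ->]] ->]]]].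
  apply/(Hcay 0 b); apply: H.
    by apply: (lift_param_in or psi pphi); rewrite /lift_domain /= row_mxKl.
  by rewrite /lift_param /oct row_mxKr row_mxKl.
rewrite /oct row_mxKr => ->; have /(Hcay a b) := H b.
by rewrite /lift_param !row_mxKl !row_mxKr !mxE.
Qed.

Theorem theorem3p5 (R : realType) (L : set 'rV[R]_4)
    (or : 'rV[R]_4 -> 'M[R]_(2, 4) -> Prop) (psi : 'rV[R]_4 -> 'rV[R]_4)
    (L_surface : submanifold 2 L) (L_oriented : orientation L or)
    (psi_section : smooth_section_Vminus L or psi) :
  cayley_submanifold (Xpsi L or psi) <->
  minimal 2 L /\ holomorphic_section L or psi.
Proof.
have key := cayley_minimal_holomorphic_at L_oriented psi_section.
split=> [[_ cay]|[/(minimalP L_oriented) Lmin hol]].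
  split=> [|p X Lp TX].
    apply/(minimalP L_oriented) => p E oE ON nu.
    have [V [phi [u [W [pphi Vu phiu EE oW]]]]] := adapted_param L_oriented oE.
    rewrite -EE in ON *; rewrite -phiu; move: nu.
    by have [+ _] := key V phi W u pphi oW Vu ON; case=> // z Xz _; exact: cay.
  have [oE ON] := oframeP L_oriented Lp.
  have [V [phi [u [W [pphi Vu phiu EE oW]]]]] := adapted_param L_oriented oE.
  rewrite -EE in ON; rewrite -phiu in TX *; move: X TX.
  by have [+ _] := key V phi W u pphi oW Vu ON; case=> // z Xz _; exact: cay.
have Xparam p : L p -> exists (V : set 'rV[R]_2) phi u (W : 'M[R]_2),
   [/\ local_param L V phi, V u, phi u = p, orthonormal_rows (W *m jacobian phi u)
     & forall z, V z -> or (phi z) (W *m jacobian phi z)].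
  move=> Lp; have [oE ON] := oframeP L_oriented Lp.
  have [V [phi [u [W [pphi Vu phiu EE oW]]]]] := adapted_param L_oriented oE.
  by exists V, phi, u, W; split=> //; rewrite EE.
split=> z Xz; have [p [chi [Lp [a [b chiE]] zE]]] := Xz;
  have [V [phi [u [W [pphi Vu phiu ON oW]]]]] := Xparam p Lp.
  exists (lift_domain V), (lift_param or psi phi),
    (row_mx u (\row_i (if i == 0 then a else b))).
  split; first exact: lift_local_param oW.
    by rewrite /lift_domain /= row_mxKl.
  by rewrite /lift_param row_mxKl row_mxKr !mxE /= phiu zE chiE.
have [_ H] := key V phi W u pphi oW Vu ON.
apply: H => //; last by rewrite zE /oct row_mxKr.
split=> [nu Nnu|X TX]; first by apply: Lmin => //; exact: oW.
by apply: hol => //; rewrite phiu.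
Qed.
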